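(* In the ring $\mathfrak P[[x]]$ of formal power series over the polytope ring, the exponential generating series $$P(x)=1+\sum_{n=1}^\infty \pi_n\frac{x^n}{n!},\qquad P^\circ(x)=1-\sum_{n=1}^\infty \pi_n^\circ\frac{x^n}{n!}$$ are multiplicatively inverse: $P(x)P^\circ(x)=1$.
   Context: $\mathfrak P$ is the commutative ring freely generated as an abelian group by combinatorial equivalence classes of convex polytopes, with multiplication given by the Cartesian product; the point is the unit $1$. For a polytope $Q$, $\mathcal F(Q)$ is the set of all nonempty faces of $Q$ (including $Q$), each regarded as an element of $\mathfrak P$. The permutohedron $\pi_n$ is the $(n-1)$-dimensional convex hull of all permutations of the vector $(1,2,\dots,n)\in\mathbb R^n$; $\pi_1$ is a point. The weighted motivic interior is $\pi_n^\circ=\sum_{f\in\mathcal F(\pi_n)}(-\pi_1)^{\operatorname{codim} f}\, f$. *)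

(* Defs.v *)
From HB Require Import structures.
From mathcomp Require Import all_boot all_order all_algebra generic_quotient.
From mathcomp Require Import perm finmap.
From mathcomp Require Import boolp classical_sets functions cardinality fsbigop.
From mathcomp Require Import reals.
From mathcomp Require Import monalg.

Set Implicit Arguments.
Unset Strict Implicit.
Unset Printing Implicit Defensive.

Import Order.TTheory GRing.Theory Num.Theory.

Local Open Scope classical_set_scope.
Local Open Scope ring_scope.

Section Polytopes.
Variable R : realType.

Definition conv_hull n (A : set 'rV[R]_n) : set 'rV[R]_n :=
  [set x | exists k (p : 'I_k -> 'rV[R]_n) (a : 'I_k -> R),
     [/\ forall i, A (p i), forall i, 0 <= a i, \sum_i a i = 1
       & x = \sum_i a i *: p i]].

(* Polytopes are nonempty, as in the face posets below. *)
Definition is_polytope n (P : set 'rV[R]_n) : Prop :=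
  exists A, [/\ finite_set A, A !=set0 & P = conv_hull A].

Record polytope n := Polytope {
  carrier :> set 'rV[R]_n;
  polytopeP : is_polytope carrier }.

HB.instance Definition _ n := gen_eqMixin (polytope n).
HB.instance Definition _ n := gen_choiceMixin (polytope n).

Lemma polytope_eq n (P Q : polytope n) : P = Q :> set _ -> P = Q.
Proof.
case: P Q => [P hP] [Q hQ] /= PQ; move: hP hQ; rewrite PQ => hP hQ.
by rewrite (Prop_irrelevance hP hQ).
Qed.

Lemma hull_fin n (A : set 'rV[R]_n) (I : finType) (p : I -> 'rV[R]_n)
    (a : I -> R) : (forall i, A (p i)) -> (forall i, 0 <= a i) ->
  \sum_i a i = 1 -> conv_hull A (\sum_i a i *: p i).
Proof.
move=> Ap a0 a1; exists #|I|, (p \o enum_val), (a \o enum_val); split => //=.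
- by rewrite -a1; apply/esym/reindex/onW_bij/enum_val_bij.
- by apply/reindex/onW_bij/enum_val_bij.
Qed.

Lemma sub_hull n (A : set 'rV[R]_n) : A `<=` conv_hull A.
Proof.
move=> x Ax; exists 1%N, (fun=> x), (fun=> 1); split => //.
- by rewrite big_ord1.
- by rewrite big_ord1 scale1r.
Qed.

Lemma polytope_neq0 n (P : polytope n) : (P : set _) !=set0.
Proof.
by case: P => P [A [_ [x Ax] PA]] /=; exists x; rewrite PA; exact: sub_hull.
Qed.

Lemma set1_hull n (x : 'rV[R]_n) : [set x] = conv_hull [set x].
Proof.
rewrite eqEsubset; split; first exact: sub_hull.
move=> _ [k [p [a [Ap _ a1 ->]]]] /=.
rewrite (eq_bigr (fun i => a i *: x)) => [|i _]; last by rewrite Ap.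
by rewrite -scaler_suml a1 scale1r.
Qed.

Lemma set1_polytope n (x : 'rV[R]_n) : is_polytope [set x].
Proof.
by exists [set x]; split; [exact: finite_set1 | exists x | exact: set1_hull].
Qed.

HB.instance Definition _ n :=
  isPointed.Build (polytope n) (Polytope (set1_polytope 0)).

Definition hull_polytope n (A : set 'rV[R]_n) (Af : finite_set A)
    (A0 : A !=set0) : polytope n :=
  Polytope (ex_intro _ A (And3 Af A0 erefl)).

(* The exposed subset of P on which the linear form x |-> x *m c is b. *)
Definition slice n (P : set 'rV[R]_n) (c : 'cV[R]_n) (b : R) : set 'rV[R]_n :=
  P `&` [set x | (x *m c) 0 0 = b].

Definition valid_ineq n (P : set 'rV[R]_n) (c : 'cV[R]_n) (b : R) : Prop :=
  forall x, P x -> (x *m c) 0 0 <= b.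

(* F(P): nonempty faces, P itself included (take c = 0 and b = 0). The empty
   face is left out because a polytope is nonempty. *)
Definition faces n (P : polytope n) : set (polytope n) :=
  [set F : polytope n | exists c b, valid_ineq P c b /\ F = slice P c b :> set _].

Lemma hullM n (c : 'cV[R]_n) k (p : 'I_k -> 'rV[R]_n) (a : 'I_k -> R) :
  ((\sum_i a i *: p i) *m c) 0 0 = \sum_i a i * (p i *m c) 0 0.
Proof.
rewrite mulmx_suml summxE; apply: eq_bigr => i _.
by rewrite -scalemxAl mxE.
Qed.

Lemma slice_hull n (A : set 'rV[R]_n) c b : valid_ineq (conv_hull A) c b ->
  slice (conv_hull A) c b = conv_hull (slice A c b).
Proof.
move=> vA; rewrite eqEsubset; split=> x.
- move=> [[k [p [a [Ap a0 a1 ->]]]] /=]; rewrite hullM => eb.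
  have t0 i : 0 <= a i * (b - (p i *m c) 0 0).
    by rewrite mulr_ge0 // subr_ge0 vA //; apply: sub_hull.
  have /eqP : \sum_i a i * (b - (p i *m c) 0 0) = 0.
    under eq_bigr do rewrite mulrBr.
    by rewrite sumrB -mulr_suml a1 mul1r eb subrr.
  rewrite psumr_eq0 // => /allP h.
  have tight i : a i != 0 -> (p i *m c) 0 0 = b.
    move=> ai; have := h i (mem_index_enum i).
    by rewrite /= mulf_eq0 (negbTE ai) subr_eq0 => /eqP ->.
  have [j aj] : exists j, a j != 0.
    apply: contrapT => /forallNP na; suff: (0 : R) = 1 by apply/eqP; rewrite eq_sym oner_eq0.
    by rewrite -a1 big1 // => i _; apply/eqP/negbNE/negP/na.
  pose q i := if a i == 0 then p j else p i.
  exists k, q, a; split => // [i|].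
    by rewrite /q; case: eqVneq => [_|ai]; split => //=; exact: tight.
  by apply: eq_bigr => i _; rewrite /q; case: eqVneq => // ->; rewrite !scale0r.
- move=> [k [p [a [Ap a0 a1 ->]]]]; split.
    by exists k, p, a; split => // i; have [] := Ap i.
  rewrite /= hullM (eq_bigr (fun i => a i * b)) => [|i _].
    by rewrite -mulr_suml a1 mul1r.
  by have [_ ->] := Ap i.
Qed.

Lemma hull0 n : conv_hull (set0 : set 'rV[R]_n) = set0.
Proof.
rewrite eqEsubset; split=> // x [[|k] [p [a [Ap _ a1 _]]]].
  by move: a1; rewrite big_ord0 => /eqP; rewrite eq_sym oner_eq0.
by have := Ap ord0.
Qed.

Lemma slice_is_polytope n (P : polytope n) c b : valid_ineq P c b ->
  slice P c b !=set0 -> is_polytope (slice P c b).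
Proof.
case: (polytopeP P) => A [Af A0 ->] vA; rewrite slice_hull // => -[x hx].
exists (slice A c b); split=> //; first by apply: sub_finite_set Af => y [].
apply/set0P/eqP => A0'; by move: hx; rewrite A0' hull0.
Qed.

Lemma faces_self n (P : polytope n) : faces P P.
Proof.
exists 0, 0; split=> [x _|]; first by rewrite mulmx0 mxE.
by rewrite eqEsubset; split=> x //=; [split=> //=; rewrite mulmx0 mxE | case].
Qed.

Lemma finite_faces n (P : polytope n) : finite_set (faces P).
Proof.
case: (polytopeP P) => A [Af _ PA].
have /(sub_finite_set _) : finite_set
    ((fun B => get [set F : polytope n | F = conv_hull B :> set _]) @`
     [set B | B `<=` A]).
  apply: finite_image.
  have /finite_seqP[s As] := Af.
  apply: (@sub_finite_set _ _
    ((fun m : (size s).-tuple bool => [set` mask m s]) @` setT)).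
    move=> B BA /=; exists (map_tuple (fun x => `[< B x >]) (in_tuple s)) => //=.
    rewrite -filter_mask eqEsubset; split=> x /=.
      by rewrite mem_filter => /andP[/asboolP].
    move=> Bx; rewrite mem_filter; apply/andP; split; first exact/asboolP.
    by have := BA _ Bx; rewrite As.
  exact/finite_image/finite_finset.
apply=> F [c [b [vP FE]]]; exists (slice A c b); first by move=> x [].
have FA : F = conv_hull (slice A c b) :> set _.
  by rewrite FE PA slice_hull // -PA.
apply: polytope_eq; rewrite FA.
by have := @getPex _ [set F : polytope n | F = conv_hull (slice A c b) :> set _]
  (ex_intro _ F FA).
Qed.

(* Dimension of the affine hull: the largest k for which A contains k + 1
   affinely independent points x, x + row 0 V, ..., x + row (k - 1) V. *)
Definition affdim n (A : set 'rV[R]_n) : nat :=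
  \max_(k < n.+1 | `[< exists (x : 'rV[R]_n) (V : 'M[R]_(k, n)),
      [/\ A x, forall i, A (x + row i V) & row_free V] >]) k.

Definition codim n (P F : polytope n) : nat := (affdim P - affdim F)%N.

Definition comb_equiv n m (P : polytope n) (Q : polytope m) : Prop :=
  exists f : polytope n -> polytope m,
    set_bij (faces P) (faces Q) f /\
    forall F G, faces P F -> faces P G -> (F `<=` G <-> f F `<=` f G).

Lemma comb_equivI n m (P : polytope n) (Q : polytope m)
    (f : polytope n -> polytope m) (g : polytope m -> polytope n) :
    (forall F, faces P F -> [/\ faces Q (f F), g (f F) = F
       & forall G, faces P G -> F `<=` G -> f F `<=` f G]) ->
    (forall F, faces Q F -> [/\ faces P (g F), f (g F) = F
       & forall G, faces Q G -> F `<=` G -> g F `<=` g G]) ->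
  comb_equiv P Q.
Proof.
move=> hf hg; exists f; split; first split.
- by move=> F /hf[].
- move=> F G /[!inE] /hf[_ gF _] /hf[_ gG _] fFG.
  by rewrite -gF fFG.
- by move=> G /hg[PG <- _]; exists (g G).
move=> F G PF PG; split; first by case: (hf F PF) => _ _; exact.
have [QF fF _] := hf F PF; have [QG fG _] := hf G PG.
by case: (hg _ QF) => _ _ /(_ _ QG); rewrite fF fG.
Qed.

Lemma comb_equivE n m (P : polytope n) (Q : polytope m) : comb_equiv P Q ->
  exists (f : polytope n -> polytope m) (g : polytope m -> polytope n),
    (forall F, faces P F -> [/\ faces Q (f F), g (f F) = F
       & forall G, faces P G -> F `<=` G -> f F `<=` f G]) /\
    (forall F, faces Q F -> [/\ faces P (g F), f (g F) = F
       & forall G, faces Q G -> F `<=` G -> g F `<=` g G]).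
Proof.
case=> f [[fPQ finj fsurj] fmon].
pose g G := get [set F | faces P F /\ f F = G].
have gP G : faces Q G -> faces P (g G) /\ f (g G) = G.
  move=> QG; have [F PF fF] := fsurj _ QG.
  exact: (@getPex _ [set F | faces P F /\ f F = G] (ex_intro _ F (conj PF fF))).
exists f, g; split=> F FP; split=> //.
- exact: fPQ.
- have [Pg fg] := gP _ (fPQ _ FP).
  by apply: finj; rewrite ?inE.
- by move=> G PG /fmon; apply.
- by have [] := gP _ FP.
- by have [] := gP _ FP.
- move=> G QG; have [PF fF] := gP _ FP; have [PG fG] := gP _ QG.
  by rewrite -{1}fF -{1}fG => /fmon; apply.
Qed.

Lemma comb_equiv_refl n (P : polytope n) : comb_equiv P P.
Proof. by apply: (@comb_equivI _ _ _ _ id id). Qed.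

Lemma comb_equiv_sym n m (P : polytope n) (Q : polytope m) :
  comb_equiv P Q -> comb_equiv Q P.
Proof. by case/comb_equivE=> f [g [hf hg]]; exact: (comb_equivI hg hf). Qed.

Lemma comb_equiv_trans n m l (P : polytope n) (Q : polytope m)
  (S : polytope l) : comb_equiv P Q -> comb_equiv Q S -> comb_equiv P S.
Proof.
case/comb_equivE=> f [g [hf hg]] /comb_equivE[h [k [hh hk]]].
apply: (@comb_equivI _ _ _ _ (h \o f) (g \o k)) => F FP /=.
- have [Qf gf fm] := hf _ FP; have [Sh kh hm] := hh _ Qf.
  split=> //; first by rewrite kh gf.
  move=> G GP FG; have [QG _ _] := hf _ GP; apply: hm => //; exact: fm.
- have [Qf gf fm] := hk _ FP; have [Sh kh hm] := hg _ Qf.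
  split=> //; first by rewrite kh gf.
  move=> G GP FG; have [QG _ _] := hk _ GP; apply: hm => //; exact: fm.
Qed.

Lemma img_is_polytope n m (f : {linear 'rV[R]_n -> 'rV[R]_m}) (P : polytope n) :
  is_polytope (f @` P).
Proof.
case: (polytopeP P) => A [Af [x Ax] ->]; exists (f @` A); split.
- exact: finite_image.
- by exists (f x), x.
rewrite eqEsubset; split=> y.
- move=> [_ [k [p [a [Ap a0 a1 ->]]]] <-].
  exists k, (f \o p), a; split=> //= [i|]; first by exists (p i).
  by rewrite linear_sum; apply: eq_bigr => i _; rewrite linearZ.
- move=> [k [p [a [Ap a0 a1 ->]]]].
  have /choice[q hq] : forall i, exists z, A z /\ f z = p i.
    by move=> i; have [z Az fz] := Ap i; exists z.
  exists (\sum_i a i *: q i).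
    by exists k, q, a; split=> // i; have [] := hq i.
  rewrite linear_sum; apply: eq_bigr => i _; rewrite linearZ /=.
  by have [_ ->] := hq i.
Qed.

Definition img n m (f : {linear 'rV[R]_n -> 'rV[R]_m}) (P : polytope n) :
  polytope m := Polytope (img_is_polytope f P).

Lemma faces_img n m (f : {linear 'rV[R]_n -> 'rV[R]_m})
    (g : {linear 'rV[R]_m -> 'rV[R]_n}) (P F : polytope n) :
  (forall x, carrier P x -> g (f x) = x) -> faces P F ->
  faces (img f P) (img f F) /\ img g (img f F) = F.
Proof.
move=> fK [c [b [vP FE]]]; split.
  exists (lin1_mx g *m c), b; split.
    by move=> _ [x Px <-]; rewrite mulmxA mul_rV_lin1 fK //; exact: vP.
  rewrite eqEsubset; split=> y /=.
    move=> [x Fx <-]; move: Fx; rewrite FE => -[Px xb].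
    by split; [exists x | rewrite /= mulmxA mul_rV_lin1 fK].
  move=> [[x Px <-]] /=; rewrite mulmxA mul_rV_lin1 fK // => xb.
  by exists x => //; rewrite FE.
apply: polytope_eq; rewrite eqEsubset; split=> x /=.
  by move=> [_ [z Fz <-] <-]; rewrite fK //; move: Fz; rewrite FE => -[].
move=> Fx; exists (f x); first by exists x.
by rewrite fK //; move: Fx; rewrite FE => -[].
Qed.

Lemma img_comb_equiv n m (f : {linear 'rV[R]_n -> 'rV[R]_m})
    (g : {linear 'rV[R]_m -> 'rV[R]_n}) (P : polytope n) (Q : polytope m) :
  (forall x, carrier P x -> carrier Q (f x) /\ g (f x) = x) ->
  (forall y, carrier Q y -> carrier P (g y) /\ f (g y) = y) -> comb_equiv P Q.
Proof.
move=> hf hg.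
have QE : img f P = Q.
  apply: polytope_eq; rewrite eqEsubset; split=> y /=.
    by move=> [x /hf[? _] <-].
  by move=> /hg[Pg fg]; exists (g y).
have PE : img g Q = P.
  apply: polytope_eq; rewrite eqEsubset; split=> y /=.
    by move=> [x /hg[? _] <-].
  by move=> /hf[Pg fg]; exists (f y).
apply: (@comb_equivI _ _ _ _ (img f) (img g)) => F FP.
- have [] := faces_img (fun x Px => (hf x Px).2) FP; rewrite QE => Qf gf.
  by split=> // G _ FG _ [x Fx <-]; exists x => //; exact: FG.
- have [] := faces_img (fun x Px => (hg x Px).2) FP; rewrite PE => Qf gf.
  by split=> // G _ FG _ [x Fx <-]; exists x => //; exact: FG.
Qed.

Definition setprod n m (P : set 'rV[R]_n) (Q : set 'rV[R]_m) :
    set 'rV[R]_(n + m) :=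
  [set z | P (lsubmx z) /\ Q (rsubmx z)].

Lemma prod_is_polytope n m (P : polytope n) (Q : polytope m) :
  is_polytope (setprod P Q).
Proof.
case: (polytopeP P) => A [Af [x0 Ax0] ->].
case: (polytopeP Q) => B [Bf [y0 By0] ->].
exists ((fun z => row_mx z.1 z.2) @` (A `*` B)); split.
- exact/finite_image/finite_setX.
- by exists (row_mx x0 y0), (x0, y0).
rewrite eqEsubset; split=> z.
- move=> [[k [p [a [Ap a0 a1 pE]]]] [l [q [b [Bq b0 b1 qE]]]]].
  have s1 : \sum_(i : 'I_k * 'I_l) a i.1 * b i.2 = 1.
    rewrite -(pair_bigA _ (fun i j => a i * b j)) /=.
    by under eq_bigr do rewrite -mulr_sumr b1 mulr1.
  suff -> : z = \sum_(i : 'I_k * 'I_l) (a i.1 * b i.2) *: row_mx (p i.1) (q i.2).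
    apply: hull_fin => // i; last exact: mulr_ge0.
    by exists (p i.1, q i.2) => //; split; [exact: Ap | exact: Bq].
  rewrite -[LHS]hsubmxK pE qE.
  rewrite -(pair_bigA _ (fun i j => (a i * b j) *: row_mx (p i) (q j))) /=.
  under [RHS]eq_bigr do under eq_bigr do rewrite scale_row_mx.
  have rs (I : finType) (u : I -> 'rV[R]_n) (v : I -> 'rV[R]_m) :
      \sum_i row_mx (u i) (v i) = row_mx (\sum_i u i) (\sum_i v i).
    elim/big_rec3: _ => [|i y1 y2 y3 _ ->]; first by rewrite row_mx0.
    by rewrite add_row_mx.
  under [RHS]eq_bigr do rewrite rs.
  rewrite rs; congr row_mx.
    apply: eq_bigr => i _; rewrite -scaler_suml; congr (_ *: _).
    by rewrite -mulr_sumr b1 mulr1.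
  rewrite exchange_big /=; apply: eq_bigr => j _.
  by rewrite -scaler_suml -mulr_suml a1 mul1r.
- move=> [k [p [a [Ap a0 a1 ->]]]]; split; rewrite linear_sum.
    exists k, (lsubmx \o p), a; split=> // [i|].
      by have [[u v] /= [Au Bv] <-] := Ap i; rewrite row_mxKl.
    by apply: eq_bigr => i _; rewrite linearZ.
  exists k, (rsubmx \o p), a; split=> // [i|].
    by have [[u v] /= [Au Bv] <-] := Ap i; rewrite row_mxKr.
  by apply: eq_bigr => i _; rewrite linearZ.
Qed.

Definition polyprod n m (P : polytope n) (Q : polytope m) : polytope (n + m) :=
  Polytope (prod_is_polytope P Q).

Lemma polyprodE n m (P : polytope n) (Q : polytope m) x y :
  carrier (polyprod P Q) (row_mx x y) <-> carrier P x /\ carrier Q y.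
Proof. by rewrite /= /setprod /= row_mxKl row_mxKr. Qed.

Lemma img_lprod n m (P : polytope n) (Q : polytope m) :
  img lsubmx (polyprod P Q) = P.
Proof.
apply: polytope_eq; rewrite eqEsubset; split=> x /=; first by move=> [z [? _] <-].
have [y Qy] := polytope_neq0 Q.
by move=> Px; exists (row_mx x y); rewrite ?row_mxKl //; apply/polyprodE.
Qed.

Lemma img_rprod n m (P : polytope n) (Q : polytope m) :
  img rsubmx (polyprod P Q) = Q.
Proof.
apply: polytope_eq; rewrite eqEsubset; split=> x /=; first by move=> [z [_ ?] <-].
have [y Py] := polytope_neq0 P.
by move=> Qx; exists (row_mx y x); rewrite ?row_mxKr //; apply/polyprodE.
Qed.

Lemma mulmx_split n m (z : 'rV[R]_(n + m)) (c : 'cV[R]_(n + m)) :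
  (z *m c) 0 0 = (lsubmx z *m usubmx c) 0 0 + (rsubmx z *m dsubmx c) 0 0.
Proof. by rewrite -{1}[z]hsubmxK -{1}[c]vsubmxK mul_row_col mxE. Qed.

Lemma faces_prod n m (P : polytope n) (Q : polytope m) H :
  faces (polyprod P Q) H <->
  exists F G, [/\ faces P F, faces Q G & H = polyprod F G].
Proof.
split=> [[c [b [vH HE]]]|[F [G [[c1 [b1 [v1 FE]]] [c2 [b2 [v2 GE]]] ->]]]]; last first.
  exists (col_mx c1 c2), (b1 + b2); split.
    move=> z [Pz Qz]; rewrite mulmx_split col_mxKu col_mxKd.
    by apply: lerD; [exact: v1 | exact: v2].
  rewrite eqEsubset; split=> z; rewrite /= /setprod /= FE GE /slice /=.
    by move=> [[Pz zb] [Qz zb']]; rewrite mulmx_split col_mxKu col_mxKd zb zb'.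
  move=> [[Pz Qz]]; rewrite mulmx_split col_mxKu col_mxKd => zb.
  have := v1 _ Pz; have := v2 _ Qz; move=> h2 h1.
  have e1 : (lsubmx z *m c1) 0 0 = b1.
    by apply/eqP; rewrite eq_le h1 /= -(lerD2r b2) -zb lerD2l.
  by split; split=> //; apply: (addrI b1); rewrite -zb e1.
have [z0 Hz0] := polytope_neq0 H.
move: (Hz0); rewrite HE => -[[Pz0 Qz0]] /=; rewrite mulmx_split.
set c1 := usubmx c; set c2 := dsubmx c.
set b1 := (lsubmx z0 *m c1) 0 0; set b2 := (rsubmx z0 *m c2) 0 0 => bE.
have v1 : valid_ineq P c1 b1.
  move=> x Px; rewrite -(lerD2r b2) bE.
  have := vH (row_mx x (rsubmx z0)); rewrite mulmx_split row_mxKl row_mxKr.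
  by apply; apply/polyprodE.
have v2 : valid_ineq Q c2 b2.
  move=> y Qy; rewrite -(lerD2l b1) bE.
  have := vH (row_mx (lsubmx z0) y); rewrite mulmx_split row_mxKl row_mxKr.
  by apply; apply/polyprodE.
have n1 : slice P c1 b1 !=set0 by exists (lsubmx z0).
have n2 : slice Q c2 b2 !=set0 by exists (rsubmx z0).
exists (Polytope (slice_is_polytope v1 n1)), (Polytope (slice_is_polytope v2 n2)).
split; [by exists c1, b1 | by exists c2, b2 | apply: polytope_eq].
rewrite HE eqEsubset; split=> z; rewrite /= /setprod /slice /= mulmx_split -/c1 -/c2 -bE.
  move=> [[Pz Qz] zb]; have h1 := v1 _ Pz; have h2 := v2 _ Qz.
  have e1 : (lsubmx z *m c1) 0 0 = b1.
    by apply/eqP; rewrite eq_le h1 /= -(lerD2r b2) -zb lerD2l.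
  by do 2!split=> //; apply: (addrI b1); rewrite -zb e1.
by move=> [[Pz ->] [Qz ->]].
Qed.

Lemma polyprodS n m (F F' : polytope n) (G G' : polytope m) :
  polyprod F G `<=` polyprod F' G' <-> F `<=` F' /\ G `<=` G'.
Proof.
split=> [S|[SF SG] z [/SF ? /SG ?]//]; split=> x hx.
- have [y Gy] := polytope_neq0 G.
  have /S/polyprodE[] // : carrier (polyprod F G) (row_mx x y) by apply/polyprodE.
- have [y Gy] := polytope_neq0 F.
  have /S/polyprodE[] // : carrier (polyprod F G) (row_mx y x) by apply/polyprodE.
Qed.

Lemma comb_equiv_prod n n' m m' (P : polytope n) (P' : polytope n')
    (Q : polytope m) (Q' : polytope m') :
  comb_equiv P P' -> comb_equiv Q Q' ->
  comb_equiv (polyprod P Q) (polyprod P' Q').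
Proof.
case/comb_equivE=> f [g [hf hg]] /comb_equivE[h [k [hh hk]]].
apply: (@comb_equivI _ _ _ _
  (fun H => polyprod (f (img lsubmx H)) (h (img rsubmx H)))
  (fun H => polyprod (g (img lsubmx H)) (k (img rsubmx H)))).
- move=> _ /faces_prod[F [G [PF QG ->]]]; rewrite !img_lprod !img_rprod.
  have [Pf gf fm] := hf _ PF; have [Qh kh hm] := hh _ QG.
  split; first by apply/faces_prod; exists (f F), (h G).
    by rewrite gf kh.
  move=> _ /faces_prod[F' [G' [PF' QG' ->]]]; rewrite !img_lprod !img_rprod.
  by move=> /polyprodS[? ?]; apply/polyprodS; split; [exact: fm | exact: hm].
- move=> _ /faces_prod[F [G [PF QG ->]]]; rewrite !img_lprod !img_rprod.
  have [Pf gf fm] := hg _ PF; have [Qh kh hm] := hk _ QG.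
  split; first by apply/faces_prod; exists (g F), (k G).
    by rewrite gf kh.
  move=> _ /faces_prod[F' [G' [PF' QG' ->]]]; rewrite !img_lprod !img_rprod.
  by move=> /polyprodS[? ?]; apply/polyprodS; split; [exact: fm | exact: hm].
Qed.

Lemma polyprodC n m (P : polytope n) (Q : polytope m) :
  comb_equiv (polyprod P Q) (polyprod Q P).
Proof.
pose sw a b (z : 'rV[R]_(a + b)) : 'rV[R]_(b + a) := row_mx (rsubmx z) (lsubmx z).
have swl a b : linear (@sw a b).
  by move=> c u v; rewrite /sw !linearP /= -add_row_mx -scale_row_mx.
pose swL a b : {linear _ -> _} := HB.pack (@sw a b)
  (GRing.isLinear.Build _ _ _ _ (@sw a b) (@swl a b)).
apply: (@img_comb_equiv _ _ (swL n m) (swL m n)) => z [Pz Qz];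
  by split; [apply/polyprodE | rewrite /= /sw row_mxKl row_mxKr hsubmxK].
Qed.

Lemma polyprodA n m l (P : polytope n) (Q : polytope m) (S : polytope l) :
  comb_equiv (polyprod P (polyprod Q S)) (polyprod (polyprod P Q) S).
Proof.
pose u (z : 'rV[R]_(n + (m + l))) : 'rV[R]_(n + m + l) :=
  row_mx (row_mx (lsubmx z) (lsubmx (rsubmx z))) (rsubmx (rsubmx z)).
pose v (z : 'rV[R]_(n + m + l)) : 'rV[R]_(n + (m + l)) :=
  row_mx (lsubmx (lsubmx z)) (row_mx (rsubmx (lsubmx z)) (rsubmx z)).
have ul : linear u.
  by move=> c x y; rewrite /u !linearP /= -!(add_row_mx, scale_row_mx).
have vl : linear v.
  by move=> c x y; rewrite /v !linearP /= -!(add_row_mx, scale_row_mx).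
pose uL : {linear _ -> _} := HB.pack u (GRing.isLinear.Build _ _ _ _ u ul).
pose vL : {linear _ -> _} := HB.pack v (GRing.isLinear.Build _ _ _ _ v vl).
apply: (@img_comb_equiv _ _ uL vL) => z.
- move=> [Pz [Qz Sz]]; split; last by rewrite /= /u /v !(row_mxKl, row_mxKr) !hsubmxK.
  by apply/polyprodE; split=> //; apply/polyprodE.
- move=> [[Pz Qz] Sz]; split; last by rewrite /= /u /v !(row_mxKl, row_mxKr) !hsubmxK.
  by apply/polyprodE; split=> //; apply/polyprodE.
Qed.

(* The one-point polytope R^0. *)
Definition pt : polytope 0 := Polytope (set1_polytope 0).

Lemma polyprod_pt n (P : polytope n) : comb_equiv (polyprod pt P) P.
Proof.
have ul : linear (fun x : 'rV[R]_n => row_mx (0 : 'rV[R]_0) x).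
  by move=> c x y; rewrite scale_row_mx add_row_mx scaler0 addr0.
pose uL : {linear _ -> _} := HB.pack (fun x : 'rV[R]_n => row_mx (0 : 'rV[R]_0) x)
  (GRing.isLinear.Build _ _ _ _ _ ul).
apply: (@img_comb_equiv _ _ rsubmx uL) => z.
- move=> [/= z0 Pz]; split=> //=.
  by rewrite -[RHS]hsubmxK z0.
- by move=> Pz; split; [apply/polyprodE | rewrite /= row_mxKr].
Qed.

Lemma comb_equiv_pt n (P : polytope n) :
  comb_equiv P pt <-> forall F, faces P F -> F = P.
Proof.
have ptF F : faces pt F -> F = pt.
  move=> [c [b [_ FE]]]; apply: polytope_eq; rewrite eqEsubset; split=> x.
    by rewrite FE => -[].
  have [y Fy] := polytope_neq0 F.
  have : carrier F y by [].
  by rewrite {1}FE => -[/= y0 _] ->; rewrite -y0.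
split=> [/comb_equivE[f [g [hf hg]]] F PF|h].
  have [/ptF fF gF _] := hf _ PF.
  have [/ptF fP gP _] := hf _ (faces_self P).
  by rewrite -gF fF -fP gP.
apply: (@comb_equivI _ _ _ _ (fun=> pt) (fun=> P)) => F.
  by move=> PF; split=> [||G _ _]; [exact: faces_self | rewrite (h _ PF) | ].
by move=> /ptF ->; split=> [||G _ _]; [exact: faces_self | | ].
Qed.

Lemma polyprod_eq_pt n m (P : polytope n) (Q : polytope m) :
  comb_equiv (polyprod P Q) pt -> comb_equiv P pt /\ comb_equiv Q pt.
Proof.
move=> /comb_equiv_pt h; split; apply/comb_equiv_pt => F PF.
- have E : polyprod F Q = polyprod P Q.
    by apply/h/faces_prod; exists F, Q; split=> //; exact: faces_self.
  by rewrite -(img_lprod F Q) E img_lprod.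
- have E : polyprod P F = polyprod P Q.
    by apply/h/faces_prod; exists P, F; split=> //; exact: faces_self.
  by rewrite -(img_rprod P F) E img_rprod.
Qed.

End Polytopes.

Section PolytopeRing.
Variable R : realType.

Definition any_polytope : Type := {n : nat & polytope R n}.
HB.instance Definition _ := Choice.on any_polytope.

Definition comb_equivb (P Q : any_polytope) : bool :=
  `[< comb_equiv (tagged P) (tagged Q) >].

Lemma comb_equivb_equiv : equiv_class_of comb_equivb.
Proof.
split=> [P|P Q|Q P S]; rewrite /comb_equivb.
- exact/asboolP/comb_equiv_refl.
- by apply: asbool_equiv_eq; split; exact: comb_equiv_sym.
- by move=> /asboolP PQ /asboolP QS; apply/asboolP/(comb_equiv_trans PQ QS).
Qed.

Canonical comb_equivb_rel : equiv_rel any_polytope := EquivRelPack comb_equivb_equiv.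

Definition comb_class : Type := {eq_quot comb_equivb_rel}%qT.
HB.instance Definition _ := Choice.on comb_class.
HB.instance Definition _ := EqQuotient.on comb_class.

Definition class_of n (P : polytope R n) : comb_class :=
  (\pi_comb_class (Tagged (polytope R) P))%qT.

Lemma class_ofP n m (P : polytope R n) (Q : polytope R m) :
  class_of P = class_of Q <-> comb_equiv P Q.
Proof.
split=> [/eqmodP/asboolP //|PQ]; exact/eqmodP/asboolP.
Qed.

Lemma class_of_surj (x : comb_class) : exists n (P : polytope R n), x = class_of P.
Proof.
by exists (tag (repr x)), (tagged (repr x)); rewrite /class_of taggedK reprK.
Qed.

Definition class_mul (x y : comb_class) : comb_class :=
  class_of (polyprod (tagged (repr x)) (tagged (repr y))).

Lemma class_mulE n m (P : polytope R n) (Q : polytope R m) :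
  class_mul (class_of P) (class_of Q) = class_of (polyprod P Q).
Proof.
apply/class_ofP/comb_equiv_prod; apply/class_ofP.
- by rewrite [LHS]/class_of taggedK reprK.
- by rewrite [LHS]/class_of taggedK reprK.
Qed.

Lemma class_mulC : commutative class_mul.
Proof.
move=> x y; have [n [P ->]] := class_of_surj x; have [m [Q ->]] := class_of_surj y.
by rewrite !class_mulE; apply/class_ofP/polyprodC.
Qed.

Lemma class_mulA : associative class_mul.
Proof.
move=> x y z; have [n [P ->]] := class_of_surj x.
have [m [Q ->]] := class_of_surj y; have [l [S ->]] := class_of_surj z.
by rewrite !class_mulE; apply/class_ofP/polyprodA.
Qed.

Lemma class_mul1 : left_id (class_of (pt R)) class_mul.
Proof.
move=> x; have [n [P ->]] := class_of_surj x.
by rewrite class_mulE; apply/class_ofP/polyprod_pt.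
Qed.

Lemma class_mul1r : right_id (class_of (pt R)) class_mul.
Proof. by move=> x; rewrite class_mulC class_mul1. Qed.

Lemma class_mul_eq1 (x y : comb_class) : class_mul x y = class_of (pt R) ->
  x = class_of (pt R) /\ y = class_of (pt R).
Proof.
have [n [P ->]] := class_of_surj x; have [m [Q ->]] := class_of_surj y.
rewrite class_mulE => /class_ofP /polyprod_eq_pt[? ?].
by split; apply/class_ofP.
Qed.

HB.instance Definition _ := Choice_isMonomialDef.Build comb_class
  class_mulA class_mul1 class_mul1r class_mul_eq1.
HB.instance Definition _ := MonomialDef_isConomialDef.Build comb_class class_mulC.

(* The free abelian group on comb_class; its product is the bilinear extension
   of class_mul. *)
Definition polytope_ring := {malg int[comb_class]}.
HB.instance Definition _ := GRing.ComNzRing.on polytope_ring.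

Definition cls n (P : polytope R n) : polytope_ring := << class_of P >>.

Lemma cls_pt : cls (pt R) = 1.
Proof. by []. Qed.

Lemma clsM n m (P : polytope R n) (Q : polytope R m) :
  cls (polyprod P Q) = cls P * cls Q.
Proof. by rewrite /cls malgM_def fgmulUU mulr1 -class_mulE. Qed.

(* The tensor product of polytope_ring with rat, where n`! is invertible. *)
Definition polytope_ringQ := {malg rat[comb_class]}.
HB.instance Definition _ := GRing.ComNzRing.on polytope_ringQ.
End PolytopeRing.

Section ScalarExtension.
Variable R : realType.

Definition toQ (g : polytope_ring R) : polytope_ringQ R :=
  mmap intr (fun k => << k >>) g.

Lemma toQE (g : polytope_ring R) k : (toQ g)@_k = (g@_k)%:~R.
Proof.
rewrite [in RHS](monalgE g) !raddf_sum /=; apply: eq_bigr => i _.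
by rewrite mulrzl raddfMz /= !mcoeffU !rmorphMn /= -mulrzl mulrnAr mulr1.
Qed.

Lemma toQ_inj : injective toQ.
Proof.
move=> g h gh; apply/malgP => k; apply/eqP.
by rewrite -(eqr_int rat) -!toQE gh.
Qed.

Fact cls_mmorphism :
  mmorphism ((fun k => << k >>) : comb_class R -> polytope_ringQ R).
Proof. by split=> // x y; rewrite malgM_def fgmulUU mulr1. Qed.

Fact toQ_additive : additive toQ.
Proof. exact: mmap_is_additive. Qed.

Fact toQ_multiplicative : multiplicative toQ.
Proof.
pose h : {mmorphism comb_class R -> polytope_ringQ R} :=
  HB.pack ((fun k => << k >>) : comb_class R -> polytope_ringQ R)
    (monalg.isMultiplicative.Build _ _ _ cls_mmorphism).
exact: (@mmap_is_multiplicative _ _ _ (intmul 1) h).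
Qed.

HB.instance Definition _ := GRing.isAdditive.Build _ _ toQ toQ_additive.
HB.instance Definition _ :=
  GRing.isMultiplicative.Build _ _ toQ toQ_multiplicative.

End ScalarExtension.

Section PowerSeries.

(* Formal power series over A, by their coefficients; coef f n is the
   coefficient of x^n. *)
Record fps (A : Type) := FPS { coef : nat -> A }.

Lemma fpsP (A : Type) (f g : fps A) : coef f =1 coef g -> f = g.
Proof. by case: f g => [f] [g] /= /funext ->. Qed.

HB.instance Definition _ (A : Type) := gen_eqMixin (fps A).
HB.instance Definition _ (A : Type) := gen_choiceMixin (fps A).

Variable A : comNzRingType.
Implicit Types f g h : fps A.

Definition fps0 : fps A := FPS (fun=> 0).
Definition fpsN f : fps A := FPS (fun n => - coef f n).
Definition fpsD f g : fps A := FPS (fun n => coef f n + coef g n).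
Definition fps1 : fps A := FPS (fun n => (n == 0%N)%:R).
Definition fpsM f g : fps A :=
  FPS (fun n => \sum_(i < n.+1) coef f i * coef g (n - i)%N).

Lemma fpsDA : associative fpsD.
Proof. by move=> f g h; apply: fpsP => n; exact: addrA. Qed.
Lemma fpsDC : commutative fpsD.
Proof. by move=> f g; apply: fpsP => n; exact: addrC. Qed.
Lemma fps0D : left_id fps0 fpsD.
Proof. by move=> f; apply: fpsP => n; exact: add0r. Qed.
Lemma fpsND : left_inverse fps0 fpsN fpsD.
Proof. by move=> f; apply: fpsP => n; exact: addNr. Qed.

HB.instance Definition _ :=
  GRing.isZmodule.Build (fps A) fpsDA fpsDC fps0D fpsND.

Let trunc N f : {poly A} := \poly_(i < N) coef f i.

Lemma coef_fpsM N f g n : (n < N)%N -> coef (fpsM f g) n = (trunc N f * trunc N g)`_n.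
Proof.
move=> nN; rewrite coefM; apply: eq_bigr => i _.
have iN : (i < N)%N by apply: leq_ltn_trans nN; rewrite -ltnS.
by rewrite !coef_poly iN (leq_ltn_trans (leq_subr _ _) nN).
Qed.

Lemma coefM_cong (p p' q q' : {poly A}) n :
  (forall i, (i <= n)%N -> p`_i = p'`_i) -> (forall i, (i <= n)%N -> q`_i = q'`_i) ->
  (p * q)`_n = (p' * q')`_n.
Proof.
move=> pp qq; rewrite !coefM; apply: eq_bigr => i _.
by rewrite pp ?qq ?leq_subr // -ltnS.
Qed.

Lemma coef_trunc N f i : (i < N)%N -> (trunc N f)`_i = coef f i.
Proof. by move=> iN; rewrite coef_poly iN. Qed.

Lemma fpsMA : associative fpsM.
Proof.
move=> f g h; apply: fpsP => n; rewrite !(@coef_fpsM n.+1) //.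
rewrite (@coefM_cong _ (trunc n.+1 f) _ (trunc n.+1 g * trunc n.+1 h)) //; last first.
  by move=> i ni; rewrite coef_trunc // (@coef_fpsM n.+1).
rewrite mulrA; apply: coefM_cong => // i ni.
by rewrite coef_trunc // (@coef_fpsM n.+1).
Qed.

Lemma fpsMC : commutative fpsM.
Proof.
by move=> f g; apply: fpsP => n; rewrite !(@coef_fpsM n.+1) // mulrC.
Qed.

Lemma fps1M : left_id fps1 fpsM.
Proof.
move=> f; apply: fpsP => n /=; rewrite big_ord_recl /= mul1r subn0 big1 ?addr0 //.
by move=> i _; rewrite mul0r.
Qed.

Lemma fpsMDl : left_distributive fpsM fpsD.
Proof.
move=> f g h; apply: fpsP => n /=; rewrite -big_split /=.
by apply: eq_bigr => i _; rewrite mulrDl.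
Qed.

Lemma fps1_neq0 : fps1 != 0.
Proof.
apply/eqP => /(congr1 (fun f => coef f 0)) /= /eqP.
by rewrite oner_eq0.
Qed.

HB.instance Definition _ := GRing.Zmodule_isComNzRing.Build (fps A)
  fpsMA fpsMC fps1M fpsMDl fps1_neq0.

End PowerSeries.

Section Permutohedra.
Variable R : realType.

Definition perm_point n (s : 'S_n) : 'rV[R]_n := \row_i (s i).+1%:R.

Lemma perm_points_neq0 n : range (@perm_point n) !=set0.
Proof. by exists (perm_point 1), 1%g. Qed.

Lemma perm_points_finite n : finite_set (range (@perm_point n)).
Proof. exact/finite_image/finite_finset. Qed.

Definition permutohedron n : polytope R n :=
  hull_polytope (@perm_points_finite n) (@perm_points_neq0 n).

(* A genuine finite sum, by finite_faces. *)
Definition motivic_interior n (P : polytope R n) : polytope_ring R :=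
  \sum_(F \in faces P) (- cls (permutohedron 1)) ^+ codim P F * cls F.

(* The series sum_(n >= 1) a_n x^n / n!. *)
Definition egf (a : nat -> polytope_ring R) : fps (polytope_ringQ R) :=
  FPS (fun n => if n == 0%N then 0 else (n`!%:R : rat)^-1 *: toQ (a n)).

End Permutohedra.

(* Main.v *)
(* A proper face of the permutohedron pi_n maximizes a linear form c that is not
   constant. Let B be the set of indices where c is minimal and k = #|B|. By an
   exchange argument every maximizing permutation puts the values 1, ..., k on B,
   so the face is pi_k x G, with pi_k in the coordinates of B and a face G of
   pi_(n-k), translated by k, in the other coordinates. Conversely every proper
   nonempty B and every face G of pi_(n-k) arise from exactly one proper face, and
   codim (pi_k x G) = 1 + codim G. Summing over the faces gives
     pi_n^o = pi_n - sum_(0 < k < n) 'C(n, k) pi_k pi_(n-k)^o,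
   which is the coefficient of x^n / n! in P P^o = 1. *)
From HB Require Import structures.
Require Import Defs.
From mathcomp Require Import all_boot all_order all_algebra.
From mathcomp Require Import perm.
From mathcomp Require Import boolp classical_sets functions cardinality fsbigop.
From mathcomp Require Import reals monalg ring.
Import Order.TTheory GRing.Theory Num.Theory.
Set Implicit Arguments.
Unset Strict Implicit.
Unset Printing Implicit Defensive.
Local Open Scope classical_set_scope.
Local Open Scope ring_scope.

(** * Affine dimension *)

Section AffineDimension.
Variable R : realType.

(** Any affinely independent family in [A] has its directions in the row space of [V], so its size
    is at most the rank [k]; the rows of [V] themselves attain [k]. *)
Lemma affdimE n (A : set 'rV[R]_n) k (x : 'rV[R]_n) (V : 'M[R]_(k, n)) :
  A x -> (forall i, A (x + row i V)) -> row_free V ->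
  (forall y, A y -> (y - x <= V)%MS) -> affdim A = k.
Proof.
move=> Ax AV Vfree Vspan; apply/eqP; rewrite eqn_leq; apply/andP; split.
  apply/bigmax_leqP => l /asboolP[y [W [Ay AW /eqP Wfree]]].
  rewrite -Wfree -(eqP Vfree); apply: mxrankS; apply/row_subP => i.
  have -> : row i W = (y + row i W - x) - (y - x).
    by rewrite opprB addrA subrK addrC addKr.
  by rewrite addmx_sub // ?eqmx_opp Vspan.
have kn : (k < n.+1)%N by rewrite ltnS -(eqP Vfree) rank_leq_col.
apply: (@leq_bigmax_cond _ _ (fun l : 'I_n.+1 => l : nat) (Ordinal kn)).
by apply/asboolP; exists x, V.
Qed.

(** Take a family of maximal size; a difference [y - x] outside its span could be appended to give a
    larger one. A point of [A] provides the family of size 0, so the maximum is attained. *)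
Lemma affdim_basis n (A : set 'rV[R]_n) : A !=set0 ->
  exists (x : 'rV[R]_n) (V : 'M[R]_(affdim A, n)),
    [/\ A x, forall i, A (x + row i V), row_free V
      & forall y, A y -> (y - x <= V)%MS].
Proof.
move=> [x0 Ax0].
pose P (k : 'I_n.+1) := `[< exists (x : 'rV[R]_n) (V : 'M[R]_(k, n)),
      [/\ A x, forall i, A (x + row i V) & row_free V] >].
have P0 : P ord0.
  apply/asboolP; exists x0, 0; split=> // [[]//|].
  by rewrite /row_free mxrank0.
have Pcard : (0 < #|P|)%N by apply/card_gt0P; exists ord0.
have [k Pk kE] := eq_bigmax_cond (fun l : 'I_n.+1 => l : nat) Pcard.
have {}kE : affdim A = k by rewrite -kE.
rewrite kE; case/asboolP: Pk => x [V [Ax AV Vfree]].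
exists x, V; split=> // y Ay; apply: contrapT => /negP yV.
have Wfree : row_free (col_mx V (y - x)).
  rewrite /row_free eqn_leq rank_leq_row /= -addsmxE addn1.
  rewrite -[X in (X < _)%N](eqP Vfree) ltn_neqAle (mxrankS (addsmxSl _ _)) andbT.
  apply: contra yV => /eqP rkE; apply: submx_trans (addsmxSr V _) _.
  by rewrite -(geq_leqif (mxrank_leqif_sup (addsmxSl V (y - x)))) rkE.
have kn : (k + 1 < n.+1)%N by rewrite ltnS -(eqP Wfree) rank_leq_col.
have : P (Ordinal kn).
  apply/asboolP; exists x, (col_mx V (y - x)); split=> //= i.
  case: (split_ordP i) => j ->; first by rewrite rowKu.
  by rewrite rowKd ord1 row_id addrC subrK.
move=> /(@leq_bigmax_cond _ _ (fun l : 'I_n.+1 => l : nat)) /=.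
by rewrite -[X in (_ <= X)%N]/(affdim A) kE addn1 ltnn.
Qed.

Lemma affdimS n (A B : set 'rV[R]_n) : A `<=` B -> (affdim A <= affdim B)%N.
Proof.
move=> AB; apply/bigmax_leqP => k /asboolP[x [V [Ax AV Vfree]]].
apply: (@leq_bigmax_cond _ _ (fun l : 'I_n.+1 => l : nat)).
by apply/asboolP; exists x, V; split=> // [|i]; apply: AB.
Qed.

(** The block diagonal matrix built from the bases of the two factors is a basis for the product. *)
Lemma affdim_prod n m (P : polytope R n) (Q : polytope R m) :
  affdim (polyprod P Q) = (affdim P + affdim Q)%N.
Proof.
have [x [V [Px PV Vfree Vspan]]] := affdim_basis (polytope_neq0 P).
have [y [W [Qy QW Wfree Wspan]]] := affdim_basis (polytope_neq0 Q).
apply: (@affdimE _ _ _ (row_mx x y) (block_mx V 0 0 W)).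
- exact/polyprodE.
- move=> i; case: (split_ordP i) => j ->.
    by rewrite rowKu row_row_mx row0 add_row_mx addr0; apply/polyprodE.
  by rewrite rowKd row_row_mx row0 add_row_mx addr0; apply/polyprodE.
- by rewrite /row_free rank_diag_block_mx (eqP Vfree) (eqP Wfree).
move=> z [Pz Qz]; have /submxP[a aE] := Vspan _ Pz.
have /submxP[b bE] := Wspan _ Qz; apply/submxP; exists (row_mx a b).
by rewrite mul_row_block !mulmx0 addr0 add0r -aE -bE -{1}[z]hsubmxK
  opp_row_mx add_row_mx.
Qed.

Lemma affdim_img n m (f : {linear 'rV[R]_n -> 'rV[R]_m}) (P : polytope R n) :
  injective f -> affdim (img f P) = affdim P.
Proof.
move=> f_inj.
have [x [V [Px PV Vfree Vspan]]] := affdim_basis (polytope_neq0 P).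
apply: (@affdimE _ _ _ (f x) (V *m lin1_mx f)).
- by exists x.
- by move=> i; exists (x + row i V); rewrite // raddfD row_mul mul_rV_lin1.
- rewrite -kermx_eq0; apply/eqP/row_matrixP => i; rewrite row0.
  have /sub_kermxP := row_sub i (kermx (V *m lin1_mx f)).
  rewrite mulmxA mul_rV_lin1 -(raddf0 f) => /f_inj /eqP.
  by rewrite mulmx_free_eq0 // => /eqP.
move=> _ [z Pz <-].
have -> : f z - f x = (z - x) *m lin1_mx f by rewrite mul_rV_lin1 raddfB.
by apply: submxMr; exact: Vspan.
Qed.

End AffineDimension.

(** * Vertices and coordinates of the permutohedron *)

Section Hulls.
Variable R : realType.

Lemma hull_valid_ineq n (A : set 'rV[R]_n) c b :
  valid_ineq A c b -> valid_ineq (conv_hull A) c b.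
Proof.
move=> vA _ [k [p [a [Ap a0 a1 ->]]]]; rewrite hullM.
rewrite -[b]mul1r -a1 mulr_suml; apply: ler_sum => i _.
by apply: ler_wpM2l => //; exact: vA.
Qed.

Lemma hull_eq_form n (A : set 'rV[R]_n) (c : 'cV[R]_n) b x :
  (forall y, A y -> (y *m c) 0 0 = b) -> conv_hull A x -> (x *m c) 0 0 = b.
Proof.
move=> Ab [k [p [a [Ap _ a1 ->]]]]; rewrite hullM.
rewrite -[RHS]mul1r -a1 mulr_suml; apply: eq_bigr => i _.
by rewrite Ab.
Qed.

Lemma mulmx_delta n (x : 'rV[R]_n) i : (x *m delta_mx i 0 : 'M_1) 0 0 = x 0 i.
Proof. by rewrite -colE mxE. Qed.

Lemma mulmx_const1 n (x : 'rV[R]_n) :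
  (x *m (const_mx 1 : 'cV_n)) 0 0 = \sum_i x 0 i.
Proof. by rewrite mxE; apply: eq_bigr => i _; rewrite mxE mulr1. Qed.

End Hulls.

Section Permutohedron.
Variable R : realType.
Local Notation permutohedron := (permutohedron R).
Local Notation perm_point := (perm_point R).

Lemma permutohedron_perm_point n (s : 'S_n) : carrier (permutohedron n) (perm_point s).
Proof. by apply: sub_hull; exists s. Qed.

Definition coord_sum n : R := \sum_(i < n) i.+1%:R.

Lemma coord_sum_neq0 n : (0 < n)%N -> coord_sum n != 0.
Proof.
case: n => // n _; apply: lt0r_neq0; rewrite /coord_sum big_ord_recl.
by apply: ltr_pwDl => //; apply: sumr_ge0 => i _; exact: ler0n.
Qed.

Lemma sum_permutohedron n x : carrier (permutohedron n) x -> \sum_i x 0 i = coord_sum n.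
Proof.
rewrite -mulmx_const1; apply: hull_eq_form => _ [s _ <-].
rewrite mulmx_const1 /coord_sum [RHS](reindex_inj (@perm_inj _ s)).
by apply: eq_bigr => i _; rewrite mxE.
Qed.

Lemma permutohedron_ge1 n x i : carrier (permutohedron n) x -> 1 <= x 0 i.
Proof.
move=> Px; have /(@hull_valid_ineq _ _ _ (- delta_mx i 0) (- 1)) :
    valid_ineq (range (@perm_point n)) (- delta_mx i 0) (- 1).
  move=> _ [s _ <-]; rewrite mulmxN mxE mulmx_delta lerN2 mxE.
  by rewrite -[1]/(1%:R) ler_nat.
by move=> /(_ _ Px); rewrite mulmxN mxE mulmx_delta lerN2.
Qed.

Lemma permutohedron_le n x i : carrier (permutohedron n) x -> x 0 i <= n%:R.
Proof.
move=> Px; have /(@hull_valid_ineq _ _ _ (delta_mx i 0) n%:R) :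
    valid_ineq (range (@perm_point n)) (delta_mx i 0) n%:R.
  by move=> _ [s _ <-]; rewrite mulmx_delta mxE ler_nat.
by move=> /(_ _ Px); rewrite mulmx_delta.
Qed.

Lemma permutohedron_coord1 n (i : 'I_n) :
  exists2 x, carrier (permutohedron n) x & x 0 i = 1.
Proof.
case: n i => [[]//|n] i; exists (perm_point (tperm ord0 i)).
  exact: permutohedron_perm_point.
by rewrite mxE tpermR.
Qed.

(** Exchanging the values at two positions moves a vertex along [e_i - e_j]. This serves both the
    exchange argument and the computation of the dimension. *)
Lemma perm_point_tperm n (u : 'S_n) i j :
  perm_point (tperm i j * u)%g =
    perm_point u + ((u j)%:R - (u i)%:R) *: (delta_mx 0 i - delta_mx 0 j).
Proof.
apply/rowP => l; rewrite !mxE permM -!natr1 /=.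
case: tpermP => [->|->|/eqP/negPf li /eqP/negPf lj]; rewrite ?eqxx ?li ?lj.
- case: eqVneq => [->|_]; first by rewrite !subrr mulr0 addr0.
  by rewrite subr0 mulr1 addrC addrA subrK.
- case: eqVneq => [->|_]; first by rewrite !subrr mulr0 addr0.
  by rewrite sub0r mulrN1 opprB [RHS]addrC addrA subrK.
- by rewrite subrr mulr0 addr0.
Qed.

(** Exchange argument: the swap changes the form by [(u j - u i) * (c i - c j)], which maximality
    makes nonpositive. *)
Lemma maximizer_lt n (u : 'S_n) (c : 'cV[R]_n) i j :
  valid_ineq (permutohedron n) c ((perm_point u *m c) 0 0) ->
  c i 0 < c j 0 -> (u i < u j)%N.
Proof.
move=> vc cij; have := vc _ (permutohedron_perm_point (tperm i j * u)%g).
rewrite perm_point_tperm mulmxDl mxE gerDl -scalemxAl mxE mulmxBl -!rowE !mxE.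
rewrite nmulr_lle0 ?subr_lt0 // subr_ge0 ler_nat ltn_neqAle => ->.
rewrite andbT; apply/negP => /eqP/val_inj/perm_inj eij.
by rewrite eij ltxx in cij.
Qed.

(** The swaps of position 0 with the other positions, applied to the identity vertex, give [n]
    independent directions. They span the hyperplane of coordinate sum 0, which contains all
    differences of points. *)
Lemma affdim_permutohedron n : affdim (permutohedron n.+1) = n.
Proof.
pose V : 'M[R]_(n, n.+1) := \matrix_(i < n)
  (i.+1%:R *: (delta_mx 0 ord0 - delta_mx 0 (lift ord0 i))).
have VE i l : V i l = i.+1%:R * ((l == ord0)%:R - (l == lift ord0 i)%:R).
  by rewrite !mxE.
apply: (@affdimE _ _ _ _ (perm_point 1%g) V).
- exact: permutohedron_perm_point.
- move=> i; suff -> : perm_point 1%g + row i V =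
      perm_point (tperm ord0 (lift ord0 i) * 1)%g.
    exact: permutohedron_perm_point.
  by rewrite perm_point_tperm rowK !perm1 subr0 lift0.
(* A right inverse: dropping coordinate 0 makes [V] diagonal with entries [-(i + 1)]. *)
- apply/row_freeP; exists (\matrix_(l, j) (- (l == lift ord0 j)%:R / j.+1%:R)).
  apply/matrixP => i j; rewrite !mxE (bigD1 (lift ord0 j)) //= big1; last first.
    by move=> l /negPf lj; rewrite [X in _ * X]mxE lj oppr0 mul0r mulr0.
  rewrite VE mxE eqxx sub0r addr0 (inj_eq lift_inj) eq_sym.
  case: eqVneq => [->|_]; last by rewrite oppr0 mulr0 mul0r.
  by rewrite mulrN1 mulN1r mulrNN divff // pnatr_eq0.
move=> y Py; set d := y - _.
(* As the coordinate sum is constant, coordinate 0 of a difference is determined by the others. *)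
have d0 : d 0 ord0 = - \sum_i d 0 (lift ord0 i).
  apply/eqP; rewrite -addr_eq0 -big_ord_recl /d.
  under eq_bigr do rewrite mxE [X in _ + X]mxE.
  rewrite sumrB (sum_permutohedron Py).
  by rewrite (sum_permutohedron (permutohedron_perm_point _)) subrr.
apply/submxP; exists (\row_i (- d 0 (lift ord0 i) / i.+1%:R)).
apply/rowP => l; rewrite [RHS]mxE.
transitivity (\sum_i (- d 0 (lift ord0 i)
   * ((l == ord0)%:R - (l == lift ord0 i)%:R))); last first.
  by apply: eq_bigr => i _; rewrite VE [X in _ = X * _]mxE mulrA divfK // pnatr_eq0.
case: (unliftP ord0 l) => [j ->|->].
  rewrite (bigD1 j) //= eqxx sub0r mulrNN mulr1 big1 ?addr0 // => i ij.
  by rewrite (inj_eq lift_inj) eq_sym (negPf ij) subrr mulr0.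
rewrite d0 -sumrN; apply: eq_bigr => i _.
by rewrite subr0 mulr1.
Qed.

Lemma cls_eq n m (P : polytope R n) (Q : polytope R m) :
  comb_equiv P Q -> cls P = cls Q.
Proof. by move=> /class_ofP PQ; rewrite /cls PQ. Qed.

(** The bounds 1 and n on the coordinates coincide for n = 1, leaving a single point. Hence the
    weight [-pi_1] of the motivic interior is the sign -1. *)
Lemma cls_permutohedron1 : cls (permutohedron 1) = 1.
Proof.
have pt1 x : carrier (permutohedron 1) x -> x = perm_point 1%g.
  move=> Px; apply/rowP => i; apply/eqP; rewrite !ord1 mxE perm1.
  by rewrite eq_le permutohedron_le ?permutohedron_ge1.
rewrite -cls_pt; apply/cls_eq/comb_equiv_pt => F [c [b [_ FE]]].
apply: polytope_eq; rewrite eqEsubset; split=> x; first by rewrite FE => -[].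
move=> /pt1 ->; have [y Fy] := polytope_neq0 F.
by move: (Fy); rewrite {1}FE => -[/pt1 <-].
Qed.

End Permutohedron.

(** * Block embeddings *)

Section BlockEmbedding.
Variable R : realType.
Variables (n k m : nat) (e : 'I_(k + m) -> 'I_n) (r : 'I_n -> 'I_(k + m)).

(* Sends (x, y) to the point with coordinates x on the first block and y + k on
   the second. On the permutohedron the coordinate sum is constant, so the
   translation by k is written as a linear map and img applies. *)
Definition block_embed (z : 'rV[R]_(k + m)) : 'rV[R]_n :=
  \row_i match fintype.split (r i) with
         | inl j => lsubmx z 0 j
         | inr j => rsubmx z 0 j + k%:R / coord_sum R k * \sum_l lsubmx z 0 l
         end.

Fact block_embed_linear : linear block_embed.
Proof.
move=> a x y; apply/rowP => i; rewrite !mxE; case: fintype.split => j; rewrite !mxE //.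
under eq_bigr do rewrite !mxE.
rewrite big_split /= -mulr_sumr mulrDr [_ * (a * _)]mulrCA mulrDr addrACA.
by congr (_ + _ * (_ * _) + (_ + _ * _)); apply: eq_bigr => l _; rewrite !mxE.
Qed.
HB.instance Definition _ :=
  GRing.isLinear.Build R _ _ _ block_embed block_embed_linear.

(** The left inverse of [block_embed]: the first block is copied unchanged, so the translation can
    be computed from it and subtracted. *)
Definition block_project (z : 'rV[R]_n) : 'rV[R]_(k + m) :=
  row_mx (\row_j z 0 (e (lshift m j)))
    (\row_j (z 0 (e (rshift k j))
             - k%:R / coord_sum R k * \sum_l z 0 (e (lshift m l)))).

Fact block_project_linear : linear block_project.
Proof.
move=> a x y; rewrite /block_project scale_row_mx add_row_mx.
congr row_mx; apply/rowP => i; rewrite !mxE //.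
under eq_bigr do rewrite !mxE.
rewrite big_split /= -mulr_sumr mulrDr [_ * (a * _)]mulrCA mulrBr.
by rewrite opprD addrACA.
Qed.
HB.instance Definition _ :=
  GRing.isLinear.Build R _ _ _ block_project block_project_linear.

Hypothesis (eK : cancel e r) (rK : cancel r e).

Lemma block_embedl x y j : block_embed (row_mx x y) 0 (e (lshift m j)) = x 0 j.
Proof.
by rewrite mxE eK; case: split_ordP => l /eqP;
  rewrite ?eq_shift // => /eqP ->; rewrite row_mxKl.
Qed.

Lemma block_embedr x y j : block_embed (row_mx x y) 0 (e (rshift k j)) =
  y 0 j + k%:R / coord_sum R k * \sum_l x 0 l.
Proof.
by rewrite mxE eK; case: split_ordP => l /eqP;
  rewrite ?eq_shift // => /eqP ->; rewrite row_mxKl row_mxKr.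
Qed.

Lemma block_embedK : cancel block_embed block_project.
Proof.
move=> z; rewrite -[z]hsubmxK; congr row_mx; apply/rowP => j; rewrite mxE.
  by rewrite block_embedl.
by rewrite block_embedr; under [in X in _ - X]eq_bigr do rewrite block_embedl;
  rewrite addrK.
Qed.

Lemma block_ord_ind (P : 'I_n -> Prop) :
  (forall a, P (e (lshift m a))) -> (forall b, P (e (rshift k b))) ->
  forall i, P i.
Proof. by move=> Pl Pr i; rewrite -[i]rK; case: (split_ordP (r i)) => j ->. Qed.

Lemma block_size : (k + m)%N = n.
Proof.
rewrite -(card_ord (k + m)) -(card_ord n).
by apply: (@bij_eq_card _ _ e); exists r.
Qed.

(** Equivalently, the [k] smallest values are taken on the first block. *)
Definition splits_blocks (u : 'S_n) : Prop :=
  forall a b, (u (e (lshift m a)) < u (e (rshift k b)))%N.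

Lemma card_ord_lt v : (v <= n)%N -> #|[set l : 'I_n | (l < v)%N]%SET| = v.
Proof.
move=> vn; rewrite -sum1dep_card -(big_ord_widen n (fun=> 1%N)) //.
by rewrite sum1_card card_ord.
Qed.

(** Counting: every value up to one taken on the first block is also taken there, so it is among the
    [k] smallest. The first block then uses up all values below [k]. *)
Lemma splits_blocks_lt u : splits_blocks u ->
  (forall a, (u (e (lshift m a)) < k)%N) /\ (forall b, (k <= u (e (rshift k b)))%N).
Proof.
move=> uP; pose U := (u \o e \o lshift m) @: [set: 'I_k]%SET.
have u_inj : injective (u \o e \o lshift m).
  by move=> a b /perm_inj/(can_inj eK)/lshift_inj.
have Ucard : #|U| = k by rewrite card_imset // cardsT card_ord.
have Ult a : (u (e (lshift m a)) < k)%N.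
  rewrite -[in X in (_ < X)%N]Ucard.
  (* [ltn_ord] is read as [v.+1 <= n], so the set counted contains the value itself. *)
  rewrite -[X in (X <= _)%N](card_ord_lt (ltn_ord (u (e (lshift m a))))).
  apply/subset_leq_card/fintype.subsetP => l; rewrite inE ltnS -[l](permKV u).
  elim/block_ord_ind: (u^-1 l)%g => [b _|b]; last by rewrite leqNgt uP.
  by rewrite /U (imset_f (u \o e \o lshift m)) // inE.
split=> // b; rewrite leqNgt; apply/negP => bk.
have UE : U = [set l : 'I_n | (l < k)%N]%SET.
  apply/eqP; rewrite eqEcard; apply/andP; split.
    by apply/fintype.subsetP => _ /imsetP[a _ ->]; rewrite inE /=.
  by rewrite card_ord_lt ?Ucard // -block_size leq_addr.
have : u (e (rshift k b)) \in U by rewrite UE inE.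
by case/imsetP=> a _ /perm_inj/(can_inj eK)/eqP; rewrite eq_shift.
Qed.

Hypothesis k_gt0 : (0 < k)%N.

Lemma block_embedr_permutohedron x y j : carrier (permutohedron R k) x ->
  block_embed (row_mx x y) 0 (e (rshift k j)) = y 0 j + k%:R.
Proof.
by move=> Px; rewrite block_embedr sum_permutohedron // divfK // coord_sum_neq0.
Qed.

(** A form constant on the first block sees only the second factor: the fixed coordinate sum of pi_k
    and the translation by [k] contribute constants. *)
Lemma block_embed_form x y (c : 'cV[R]_n) g : carrier (permutohedron R k) x ->
    (forall a, c (e (lshift m a)) 0 = g) ->
  (block_embed (row_mx x y) *m c) 0 0 =
    g * coord_sum R k + k%:R * \sum_b c (e (rshift k b)) 0
      + (y *m (\col_b c (e (rshift k b)) 0)) 0 0.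
Proof.
move=> Px cg; rewrite mxE (reindex e) /=; last first.
  by apply: onW_bij; exists r.
rewrite big_split_ord /= -addrA; congr (_ + _).
  rewrite -(sum_permutohedron Px) mulr_sumr; apply: eq_bigr => a _.
  by rewrite block_embedl cg mulrC.
rewrite mxE mulr_sumr -big_split /=; apply: eq_bigr => b _.
by rewrite block_embedr_permutohedron // mulrDl addrC mxE.
Qed.

(** The permutation [u] follows [s] on the first block and [t], raised by [k], on the second. *)
Lemma block_embed_perm_point (s : 'S_k) (t : 'S_m) : exists2 u : 'S_n,
  splits_blocks u &
  block_embed (row_mx (perm_point R s) (perm_point R t)) = perm_point R u.
Proof.
pose f (i : 'I_n) : 'I_n := cast_ord block_size
  match fintype.split (r i) with inl a => lshift m (s a) | inr b => rshift k (t b) end.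
have fl a : f (e (lshift m a)) = cast_ord block_size (lshift m (s a)).
  by rewrite /f eK; case: split_ordP => l /eqP; rewrite ?eq_shift // => /eqP ->.
have fr b : f (e (rshift k b)) = cast_ord block_size (rshift k (t b)).
  by rewrite /f eK; case: split_ordP => l /eqP; rewrite ?eq_shift // => /eqP ->.
have f_inj : injective f.
  move=> i j; elim/block_ord_ind: i => a; elim/block_ord_ind: j => b;
    rewrite ?(fl, fr) => /cast_ord_inj/eqP; rewrite eq_shift //;
    by move/eqP/perm_inj ->.
exists (perm f_inj); first by move=> a b; rewrite !permE fl fr ltn_addr //=.
apply/rowP; elim/block_ord_ind => j; rewrite [RHS]mxE permE.
  by rewrite block_embedl fl mxE.
rewrite block_embedr_permutohedron; last exact: permutohedron_perm_point.
by rewrite fr mxE -natrD addSn addnC.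
Qed.

Lemma splits_blocks_perm_point u : splits_blocks u ->
  exists (s : 'S_k) (t : 'S_m),
    perm_point R u = block_embed (row_mx (perm_point R s) (perm_point R t)).
Proof.
move=> /splits_blocks_lt[ul ur].
have tlt b : (u (e (rshift k b)) - k < m)%N.
  by rewrite ltn_subLR // block_size.
pose sf a := Ordinal (ul a); pose tf b := Ordinal (tlt b).
have s_inj : injective sf.
  by move=> a b [] /val_inj/perm_inj/(can_inj eK)/lshift_inj.
have t_inj : injective tf.
  move=> a b [] /(congr1 (addn k)); rewrite !subnKC //.
  by move=> /val_inj/perm_inj/(can_inj eK)/rshift_inj.
exists (perm s_inj), (perm t_inj); apply/rowP; elim/block_ord_ind => j.
  by rewrite block_embedl !mxE permE.
rewrite block_embedr_permutohedron ?mxE ?permE /=.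
  by rewrite -natrD addSn subnK.
exact: permutohedron_perm_point.
Qed.

(** The embedding matches pairs of vertices with block-splitting permutations. A pair of convex
    combinations is one convex combination of pairs, with the products of the weights. *)
Lemma block_embed_hull :
  block_embed @` setprod (permutohedron R k) (permutohedron R m) =
  conv_hull [set perm_point R u | u in splits_blocks].
Proof.
rewrite eqEsubset; split=> z.
  move=> [w [[p [x [a [xP a0 a1 xE]]]] [q [y [b [yP b0 b1 yE]]]]] <-].
  rewrite -[w]hsubmxK xE yE.
  have -> : row_mx (\sum_i a i *: x i) (\sum_j b j *: y j) =
      \sum_(i : 'I_p * 'I_q) (a i.1 * b i.2) *: row_mx (x i.1) (y i.2).
    rewrite -[RHS]hsubmxK !linear_sum /=; congr row_mx.
      rewrite -(pair_bigA _ (fun i j => lsubmx ((a i * b j) *: row_mx (x i) (y j)))).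
      apply: eq_bigr => i _ /=; under eq_bigr do rewrite linearZ /= row_mxKl.
      by rewrite -scaler_suml -mulr_sumr b1 mulr1.
    rewrite -(pair_bigA _ (fun i j => rsubmx ((a i * b j) *: row_mx (x i) (y j)))).
    rewrite exchange_big; apply: eq_bigr => j _ /=.
    under eq_bigr do rewrite linearZ /= row_mxKr.
    by rewrite -scaler_suml -mulr_suml a1 mul1r.
  rewrite linear_sum; under eq_bigr do rewrite linearZ /=.
  apply: hull_fin => [i|i|]; first 1 last.
  - exact: mulr_ge0.
  - rewrite -(pair_bigA _ (fun i j => a i * b j)) /=.
    by under eq_bigr do rewrite -mulr_sumr b1 mulr1.
  have [s _ <-] := xP i.1; have [t _ <-] := yP i.2.
  by have [u uP ->] := block_embed_perm_point s t; exists u.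
move=> [q [p [a [pP a0 a1 ->]]]].
have /choice[st stE] : forall i, exists st : 'S_k * 'S_m,
    p i = block_embed (row_mx (perm_point R st.1) (perm_point R st.2)).
  move=> i; have [u uP <-] := pP i.
  by have [s [t E]] := splits_blocks_perm_point uP; exists (s, t).
exists (\sum_i a i *: row_mx (perm_point R (st i).1) (perm_point R (st i).2)).
  split; rewrite linear_sum /=; under eq_bigr do rewrite linearZ /=;
    apply: hull_fin => // i; rewrite ?row_mxKl ?row_mxKr.
  - by exists (st i).1.
  - by exists (st i).2.
rewrite linear_sum; apply: eq_bigr => i _.
by rewrite linearZ stE.
Qed.

End BlockEmbedding.

(** * Faces of the permutohedron as products *)

Section BlockFaces.
Variable R : realType.
Variables (n k m : nat) (e : 'I_(k + m) -> 'I_n) (r : 'I_n -> 'I_(k + m)).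
Hypothesis (eK : cancel e r) (rK : cancel r e) (k_gt0 : (0 < k)%N).
Local Notation block_embed := (@block_embed R n k m r).
Local Notation permutohedron := (permutohedron R).

Definition block_face (G : polytope R m) : polytope R n :=
  img block_embed (polyprod (permutohedron k) G).

(** The form left on the second factor, and the bound left after removing the constants found in
    [block_embed_form]. *)
Let c1 (c : 'cV[R]_n) : 'cV[R]_m := \col_b c (e (rshift k b)) 0.
Let b1 (c : 'cV[R]_n) (b g : R) : R :=
  b - (g * coord_sum R k + k%:R * \sum_b c (e (rshift k b)) 0).

(** By the exchange argument every vertex on the slice splits the blocks, so the slice lies in the
    embedded product. There the form differs from [c1 c] by a constant. *)
Lemma block_slice (c : 'cV[R]_n) b g :
  (forall j, c (e (lshift m j)) 0 = g) -> (forall j, g < c (e (rshift k j)) 0) ->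
  valid_ineq (permutohedron n) c b ->
  valid_ineq (permutohedron m) (c1 c) (b1 c b g) /\
  slice (permutohedron n) c b =
    block_embed @`
      setprod (permutohedron k) (slice (permutohedron m) (c1 c) (b1 c b g)).
Proof.
move=> cl cr vc; have vV : valid_ineq (range (@perm_point R n)) c b.
  by move=> x Vx; apply/vc/sub_hull.
pose W := [set perm_point R u | u in splits_blocks e].
have WV : W `<=` range (@perm_point R n) by move=> _ [u _ <-]; exists u.
have sliceW : slice (range (@perm_point R n)) c b = slice W c b.
  rewrite eqEsubset; split=> x [xV xb]; split=> //; last exact: WV.
  case: xV xb => u _ <- /= ub; exists u => // i j.
  by apply: (@maximizer_lt _ _ _ c); rewrite ?ub ?cl.
have sliceE : slice (permutohedron n) c b = slice (conv_hull W) c b.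
  rewrite [LHS]slice_hull // sliceW -slice_hull //.
  by apply: hull_valid_ineq => x /WV/vV.
rewrite sliceE -(block_embed_hull R eK rK k_gt0).
have formE x y : carrier (permutohedron k) x ->
    (block_embed (row_mx x y) *m c) 0 0 = b + ((y *m c1 c) 0 0 - b1 c b g).
  move=> Px; rewrite (block_embed_form eK rK k_gt0 y Px cl).
  by rewrite /b1 opprB addrCA subrKC addrC.
split.
  (* Any point of pi_k completes [y] to a point of pi_n, where the given inequality applies. *)
  move=> y Py; have [x Px] := polytope_neq0 (permutohedron k).
  rewrite -subr_le0 -(lerD2l b) -(formE x) // addr0; apply: vc.
  suff : conv_hull W (block_embed (row_mx x y)).
    move=> [q [p [a [pW a0 aS E]]]]; exists q, p, a; split=> // i.
    exact/WV/pW.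
  rewrite -(block_embed_hull R eK rK k_gt0); exists (row_mx x y) => //.
  exact/polyprodE.
rewrite eqEsubset; split=> z.
  move=> [[w [Pw Qw] <-]] /=; rewrite -{1}[w]hsubmxK formE // => /eqP.
  rewrite -subr_eq0 addrAC subrr add0r subr_eq0 => /eqP wb.
  by exists w.
move=> [w [Pw [Qw wb]] <-]; split; first by exists w.
by rewrite /= -{1}[w]hsubmxK formE // wb subrr addr0.
Qed.

Lemma block_face_of_slice (F : polytope R n) (c : 'cV[R]_n) b g :
  (forall j, c (e (lshift m j)) 0 = g) -> (forall j, g < c (e (rshift k j)) 0) ->
  valid_ineq (permutohedron n) c b -> F = slice (permutohedron n) c b :> set _ ->
  exists2 G, faces (permutohedron m) G & F = block_face G.
Proof.
move=> cl cr vc FE; have [v1 sE] := block_slice cl cr vc.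
have [z Fz] := polytope_neq0 F; move: (Fz); rewrite {1}FE sE => -[w [_ Qw] _].
have s0 : slice (permutohedron m) (c1 c) (b1 c b g) !=set0 by exists (rsubmx w).
exists (Polytope (slice_is_polytope v1 s0)); first by exists (c1 c), (b1 c b g).
by apply: polytope_eq; rewrite FE sE.
Qed.

(** The form defining [G] is extended to the first block by a constant smaller than all its
    coefficients, and its maximum over pi_n is taken as bound. *)
Lemma faces_block_face (G : polytope R m) : faces (permutohedron m) G ->
  faces (permutohedron n) (block_face G).
Proof.
move=> [d [a [vd GE]]]; pose g := - \sum_j `|d j 0| - 1.
pose c : 'cV[R]_n := \col_i
  match fintype.split (r i) with inl _ => g | inr j => d j 0 end.
have cl j : c (e (lshift m j)) 0 = g.
  by rewrite mxE eK; case: split_ordP => l /eqP; rewrite ?eq_shift.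
have crE j : c (e (rshift k j)) 0 = d j 0.
  rewrite mxE eK; case: split_ordP => l /eqP; rewrite ?eq_shift //.
  by move/eqP ->.
have cr j : g < c (e (rshift k j)) 0.
  rewrite crE; apply: (@lt_le_trans _ _ (- `|d j 0|)).
    by rewrite /g -opprD ltrN2 (bigD1 j) //= -addrA ltrDl ltr_wpDl // sumr_ge0.
  by rewrite lerNl -normrN ler_norm.
have c1E : c1 c = d by apply/colP => j; rewrite mxE crE.
pose u := [arg max_(u > (1%g : 'S_n)) (perm_point R u *m c) 0 0]%O.
have vc : valid_ineq (permutohedron n) c ((perm_point R u *m c) 0 0).
  apply: hull_valid_ineq => _ [v _ <-]; rewrite /u.
  by case: arg_maxP => // w _; apply.
have [] := block_slice cl cr vc; rewrite c1E.
set b := b1 _ _ _ => v1 sE.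
have /= : slice (permutohedron n) c ((perm_point R u *m c) 0 0) (perm_point R u).
  by split=> //; exact: permutohedron_perm_point.
rewrite sE => -[w [_ [Qw wb]] _].
have [y Gy] := polytope_neq0 G; move: (Gy); rewrite {1}GE => -[Qy ya].
(* Both [a] and [b] are attained upper bounds of the same form on pi_m. *)
have ab : a = b.
  by apply/eqP; rewrite eq_le -{1}ya -{2}wb v1 // vd.
exists c, ((perm_point R u *m c) 0 0); split=> //.
by rewrite sE -ab -GE.
Qed.

Lemma block_face_inj : injective block_face.
Proof.
move=> G H GH; rewrite -(img_rprod (permutohedron k) G).
rewrite -(img_rprod (permutohedron k) H); congr (img _ _).
have imgK P : img (block_project e) (img block_embed P) = P.
  apply: polytope_eq; rewrite eqEsubset; split=> x /=.
    by move=> [_ [z Pz <-] <-]; rewrite block_embedK.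
  by move=> Px; exists (block_embed x); [exists x | rewrite block_embedK].
by rewrite -[LHS]imgK -[RHS]imgK -/(block_face G) GH.
Qed.

Lemma cls_block_face G : cls (block_face G) = cls (permutohedron k) * cls G.
Proof.
rewrite -clsM; apply: cls_eq; apply/comb_equiv_sym.
apply: (@img_comb_equiv _ _ _ block_embed (block_project e)) => [x Px|_ [x Px <-]].
  by split; [exists x | rewrite /= block_embedK].
by rewrite /= !block_embedK.
Qed.

(** The dimensions are [k + m - 1] for pi_n and [(k - 1) + dim G] for the face, against [m - 1] for
    pi_m. *)
Lemma codim_block_face G : (0 < m)%N -> faces (permutohedron m) G ->
  codim (permutohedron n) (block_face G) = (codim (permutohedron m) G).+1.
Proof.
move=> m_gt0 GP; have GS : G `<=` permutohedron m by case: GP => c [b [_ ->]] x [].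
have := affdimS GS; rewrite /codim affdim_img; last exact/can_inj/(block_embedK eK).
rewrite affdim_prod -(block_size eK rK).
case: k k_gt0 m m_gt0 G {GP GS} => // k' _ [//|m'] _ G.
rewrite addSn !affdim_permutohedron => Gm.
(* Subtraction is truncated, so [dim G <= dim pi_m] is needed to extract the successor. *)
by rewrite subnDl subSn.
Qed.

(** Coordinates in the first block are at most [k], those in the second at least [k + 1]. This
    separation allows the first block to be recovered from the face. *)
Lemma block_face_lt G a b z : faces (permutohedron m) G ->
  carrier (block_face G) z -> z 0 (e (lshift m a)) < z 0 (e (rshift k b)).
Proof.
move=> [c [d [_ GE]]] [w [Pw]]; rewrite [X in X _]GE => -[Qw _] <-.
rewrite -[w]hsubmxK block_embedl // block_embedr_permutohedron //.
rewrite (le_lt_trans (permutohedron_le a Pw)) // ltrDr.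
exact/(lt_le_trans ltr01)/permutohedron_ge1.
Qed.

Lemma block_face_coord1 G a : exists2 z, carrier (block_face G) z &
  z 0 (e (lshift m a)) = 1.
Proof.
have [x Px xa] := permutohedron_coord1 R a; have [y Gy] := polytope_neq0 G.
exists (block_embed (row_mx x y)); last by rewrite block_embedl.
by exists (row_mx x y) => //; apply/polyprodE.
Qed.

End BlockFaces.

(** * Faces indexed by subsets *)

Section Facets.
Variable R : realType.
Local Notation permutohedron := (permutohedron R).
Variable n : nat.
Implicit Types B : {set 'I_n}.

(** Lists [B] first and its complement after, to serve as the bijection [e] of the block
    embedding. *)
Definition set_enum B (p : 'I_(#|B| + #|~: B|)) : 'I_n :=
  match fintype.split p with inl a => enum_val a | inr b => enum_val b end.

Lemma set_enuml B a : set_enum (lshift #|~: B| a) = enum_val a.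
Proof.
by rewrite /set_enum; case: split_ordP => l /eqP; rewrite ?eq_shift // => /eqP ->.
Qed.

Lemma set_enumr B b : set_enum (rshift #|B| b) = enum_val b.
Proof.
by rewrite /set_enum; case: split_ordP => l /eqP; rewrite ?eq_shift // => /eqP ->.
Qed.

Lemma set_enum_inv B : exists r : 'I_n -> 'I_(#|B| + #|~: B|),
  cancel (@set_enum B) r /\ cancel r (@set_enum B).
Proof.
suff [r rK Kr] : bijective (@set_enum B) by exists r.
apply: inj_card_bij; last by rewrite !card_ord cardsC card_ord.
have disj (a : 'I_#|B|) (b : 'I_#|~: B|) : enum_val a <> enum_val b.
  by move=> ab; have := enum_valP b; rewrite -ab inE enum_valP.
move=> p q; case: (split_ordP p) => a ->; case: (split_ordP q) => b ->;
  rewrite ?(set_enuml, set_enumr).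
- by move/enum_val_inj ->.
- by move/disj.
- by move/esym/disj.
- by move/enum_val_inj ->.
Qed.

Definition set_rank B := sval (cid (set_enum_inv B)).

Lemma set_enumK B : cancel (@set_enum B) (set_rank B).
Proof. by rewrite /set_rank; case: cid => r []. Qed.

Lemma set_rankK B : cancel (set_rank B) (@set_enum B).
Proof. by rewrite /set_rank; case: cid => r []. Qed.

Lemma set_enum_in B i : i \in B -> exists a, i = set_enum (lshift #|~: B| a).
Proof. by move=> iB; exists (enum_rank_in iB i); rewrite set_enuml enum_rankK_in. Qed.

Lemma set_enum_notin B i : i \notin B -> exists b, i = set_enum (rshift #|B| b).
Proof.
rewrite -finset.in_setC => iB; exists (enum_rank_in iB i).
by rewrite set_enumr enum_rankK_in.
Qed.

(** When faces are described by ordered set partitions, [B] is the first block and [G] encodes the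
    partition of the rest. *)
Definition facet_face B (G : polytope R #|~: B|) : polytope R n :=
  block_face (set_rank B) G.

Lemma facet_face_lt B (G : polytope R #|~: B|) z i j :
  faces (permutohedron #|~: B|) G -> carrier (facet_face G) z ->
  i \in B -> j \notin B -> z 0 i < z 0 j.
Proof.
move=> GP Gz iB jB; have [a ->] := set_enum_in iB; have [b ->] := set_enum_notin jB.
apply: block_face_lt GP Gz; first exact: set_enumK.
by apply/card_gt0P; exists i.
Qed.

Lemma facet_face_coord1 B (G : polytope R #|~: B|) i :
  i \in B -> exists2 z, carrier (facet_face G) z & z 0 i = 1.
Proof.
move=> iB; have [a ->] := set_enum_in iB.
by apply: block_face_coord1; exact: set_enumK.
Qed.

Lemma faces_facet_face B (G : polytope R #|~: B|) : B != finset.set0 ->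
  faces (permutohedron #|~: B|) G -> faces (permutohedron n) (facet_face G).
Proof.
rewrite -card_gt0 => B0.
exact: (faces_block_face (@set_enumK B) (@set_rankK B) B0).
Qed.

Lemma face_sub m (P F : polytope R m) : faces P F -> F `<=` P.
Proof. by move=> [c [b [_ ->]]] x []. Qed.

(** For [i] in [B] some point of the face has coordinate 1 at [i]. If [i] were outside [B'], a
    coordinate in [B'] would be smaller still, below the minimum 1. By symmetry the face determines
    [B]. *)
Lemma facet_face_sub B B' (G : polytope R #|~: B|) (G' : polytope R #|~: B'|) :
  B != finset.set0 -> B' != finset.set0 -> faces (permutohedron #|~: B|) G ->
  faces (permutohedron #|~: B'|) G' ->
  facet_face G = facet_face G' -> (B \subset B')%SET.
Proof.
move=> B0 /set0Pn[j jB'] GP GP' GG'; apply/fintype.subsetP => i iB.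
apply: contrapT => /negP iB'; have [z Fz zi] := facet_face_coord1 G iB.
have zj := permutohedron_ge1 j (face_sub (faces_facet_face B0 GP) Fz).
rewrite GG' in Fz; have := facet_face_lt GP' Fz jB' iB'.
by rewrite zi ltNge zj.
Qed.

Lemma facet_face_neq B (G : polytope R #|~: B|) : B != finset.set0 ->
  B != [set: 'I_n]%SET -> faces (permutohedron #|~: B|) G ->
  facet_face G <> permutohedron n.
Proof.
move=> /set0Pn[i iB]; rewrite -finset.subTset => /fintype.subsetPn[j _ jB] GP E.
have [z Pz zj] := permutohedron_coord1 R j.
have zi := permutohedron_ge1 i Pz; rewrite -E in Pz.
by have := facet_face_lt GP Pz iB jB; rewrite zj ltNge zi.
Qed.

Lemma proper_face_facet_face F : faces (permutohedron n) F -> F <> permutohedron n ->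
  exists B, [/\ B != finset.set0, B != [set: 'I_n]%SET
    & exists2 G, faces (permutohedron #|~: B|) G & F = facet_face G].
Proof.
move=> FP Fn; have [c [b [vc FE]]] := FP.
(* Were [c] constant, the fixed coordinate sum would make the form constant on pi_n and the face
   would be all of pi_n. *)
have [[i j] /= cij] : exists ij, c ij.1 0 < c ij.2 0.
  apply: contrapT => /forallNP nlt; apply: Fn; apply: polytope_eq.
  rewrite FE eqEsubset; split=> x; first by case.
  move=> Px; split=> //=; have [y Fy] := polytope_neq0 F.
  move: Fy; rewrite {1}FE => -[Py <-]; rewrite !mxE.
  have cst i j : c i 0 = c j 0.
    have := nlt (i, j); have := nlt (j, i) => /= /negP + /negP.
    by rewrite -!leNgt => ij ji; apply/eqP; rewrite eq_le ij.
  case: n c x y Px Py cst {FP FE vc nlt} => [|n'] c x y Px Py cst.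
    by rewrite !big_ord0.
  under eq_bigr do rewrite (cst _ ord0).
  under [RHS]eq_bigr do rewrite (cst _ ord0).
  by rewrite -!mulr_suml !sum_permutohedron.
pose i0 := [arg min_(l < i) c l 0]%O.
have i0P l : c i0 0 <= c l 0 by rewrite /i0; case: arg_minP => // l0 _; apply.
(* The set where [c] is minimal is the first block; it misses [j] because [c j] exceeds [c i]. *)
pose B := [set l | c l 0 == c i0 0]%SET.
have B0 : B != finset.set0 by apply/set0Pn; exists i0; rewrite inE.
exists B; split=> //.
  apply: contraTneq cij => BT; have : j \in B by rewrite BT inE.
  by rewrite inE => /eqP ->; rewrite -leNgt.
rewrite -card_gt0 in B0.
apply: (block_face_of_slice (@set_enumK B) (@set_rankK B) B0 (g := c i0 0) _ _ vc FE).
  move=> a; rewrite set_enuml; apply/eqP.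
  by have := enum_valP a; rewrite inE.
move=> a; rewrite set_enumr lt_neqAle i0P andbT eq_sym.
by have := enum_valP a; rewrite !inE.
Qed.

Lemma cls_facet_face B (G : polytope R #|~: B|) :
  cls (facet_face G) = cls (permutohedron #|B|) * cls G.
Proof. exact/cls_block_face/set_enumK. Qed.

Lemma codim_facet_face B (G : polytope R #|~: B|) :
  B != finset.set0 -> B != [set: 'I_n]%SET -> faces (permutohedron #|~: B|) G ->
  codim (permutohedron n) (facet_face G) = (codim (permutohedron #|~: B|) G).+1.
Proof.
rewrite -card_gt0 => B0 BT.
apply: (codim_block_face (@set_enumK B) (@set_rankK B) B0).
rewrite card_gt0; apply: contraNneq BT => BC.
by rewrite -[B]finset.setCK BC finset.setC0.
Qed.

Lemma facet_face_inj B : injective (@facet_face B).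
Proof. exact/block_face_inj/set_enumK. Qed.

Definition proper_nonempty B := (B != finset.set0) && (B != [set: 'I_n]%SET).

(** The union runs over a list, so that the sum over faces can be split by [fsbig_bigcup_seq]. *)
Lemma faces_permutohedron : faces (permutohedron n) =
  [set permutohedron n] `|` \bigcup_(B in [set` enum proper_nonempty])
    (@facet_face B @` faces (permutohedron #|~: B|)).
Proof.
rewrite eqEsubset; split=> F.
  move=> FP; have [->|Fn] := pselect (F = permutohedron n); first by left.
  right; have [B [B0 BT [G GP FG]]] := proper_face_facet_face FP Fn.
  by exists B; [rewrite /= mem_enum; apply/andP | exists G].
case=> [->|[B /=]]; first exact: faces_self.
by rewrite mem_enum => /andP[B0 _] [G GP <-]; exact: faces_facet_face.
Qed.

End Facets.

(** * Sums over disjoint unions *)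

Section FiniteSupportSums.

Lemma fsbig_bigcup_seq (V : nmodType) (I T : choiceType) (s : seq I)
    (S : I -> set T) (F : T -> V) : uniq s ->
  (forall i, finite_set (S i)) ->
  {in s &, forall i j x, S i x -> S j x -> i = j} ->
  \sum_(x \in \bigcup_(i in [set` s]) S i) F x =
    \sum_(i <- s) \sum_(x \in S i) F x.
Proof.
move=> + Sfin; rewrite bigcup_seq; elim: s => [|i s IHs].
  by rewrite !big_nil fsbig_set0.
move=> /= /andP[iNs s_uniq] Sinj; rewrite !big_cons fsbigU0 ?IHs //.
- by move=> j l js ls; apply: Sinj; rewrite inE ?js ?ls orbT.
- by rewrite -bigcup_seq; apply: bigcup_finite.
rewrite -bigcup_seq => x [Six [j js Sjx]].
have ij : i = j.
  by apply: (Sinj i j _ _ x) => //; rewrite inE ?eqxx // [X in _ || X]js orbT.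
by move: iNs; rewrite ij [X in ~~ X]js.
Qed.

End FiniteSupportSums.

(** * Recursion for the motivic interior *)

Section Recursion.
Variable R : realType.
Local Notation permutohedron := (permutohedron R).

(** The one extra codimension of [pi_k x G] over [G] becomes the minus sign of the recursion. *)
Lemma sign_exprS_mul (A : comNzRingType) (x y : A) k :
  (- 1) ^+ k.+1 * (x * y) = - x * ((- 1) ^+ k * y).
Proof. by rewrite exprS -mulrA mulN1r mulNr mulrCA. Qed.

(** The face pi_n itself has codimension 0 and gives the first term. The proper faces are grouped by
    [B], and in each group the factor [-pi_k] comes out of the sum over [G]. *)
Lemma motivic_interior_permutohedron n :
  motivic_interior (permutohedron n) = cls (permutohedron n) -
    \sum_(B : {set 'I_n} | proper_nonempty B)
      cls (permutohedron #|B|) * motivic_interior (permutohedron #|~: B|).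
Proof.
rewrite {1}/motivic_interior; under eq_fsbigr do rewrite cls_permutohedron1.
have imfin B : finite_set (@facet_face R n B @` faces (permutohedron #|~: B|)).
  exact/finite_image/finite_faces.
have setP (B : {set 'I_n}) : B \in enum (@proper_nonempty n) ->
    B != finset.set0 /\ B != [set: 'I_n]%SET.
  by rewrite mem_enum => /andP.
rewrite faces_permutohedron fsbigU0; last first.
- move=> _ [-> [B /setP[B0 BT] [G GP]]].
  exact: facet_face_neq.
- by apply: bigcup_finite => //; exact: finite_seq.
- exact: finite_set1.
have codim_self : codim (permutohedron n) (permutohedron n) = 0%N.
  by rewrite /codim subnn.
rewrite fsbig_set1 codim_self expr0 mul1r; congr (_ + _).
(* The groups are disjoint: equal faces force inclusion of their sets [B] both ways. *)
rewrite fsbig_bigcup_seq ?enum_uniq //; last first.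
  move=> B B' /setP[B0 _] /setP[B0' _] F [G GP <-] [G' GP' E].
  apply/eqP; rewrite finset.eqEsubset.
  by rewrite (facet_face_sub B0 B0' GP GP') // (facet_face_sub B0' B0 GP' GP).
rewrite big_enum /= -sumrN; apply: eq_bigr => B /andP[B0 BT].
rewrite fsbig_image; last by move=> G H _ _; exact: facet_face_inj.
rewrite /motivic_interior -mulNr fsbig_distrr; last exact: finite_faces.
apply: eq_fsbigr => G; rewrite inE => GP.
rewrite (codim_facet_face B0 BT GP) cls_facet_face cls_permutohedron1.
exact: sign_exprS_mul.
Qed.

End Recursion.

(** * Generating series *)

Section Recurrence.
Variable R : realType.
Local Notation permutohedron := (permutohedron R).

(** Grouping by cardinality; the excluded indices 0 and n belong to the empty and the full set. *)
Lemma sum_proper_nonempty (V : nmodType) n (F : nat -> nat -> V) :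
  \sum_(B : {set 'I_n} | proper_nonempty B) F #|B| #|~: B| =
    \sum_(i < n.+1 | (i != ord0) && (i != ord_max)) F i (n - i)%N *+ 'C(n, i).
Proof.
have cardB (B : {set 'I_n}) : (#|B| < n.+1)%N.
  by rewrite ltnS -[X in (_ <= X)%N]card_ord max_card.
rewrite (partition_big (fun B => Ordinal (cardB B))
  (fun i => (i != ord0) && (i != ord_max))) /=; last first.
  move=> B /andP[B0 BT]; rewrite -!val_eqE /= cards_eq0 B0 /=.
  apply: contra BT => /eqP Bn; rewrite finset.eqEcard finset.subsetT.
  by rewrite cardsT card_ord Bn leqnn.
apply: eq_bigr => i /andP[i0 imax].
rewrite (eq_bigl (fun B => B \in [set B : {set 'I_n} | #|B| == i]%SET)).
  rewrite (eq_bigr (fun=> F i (n - i)%N)) => [|B].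
    by rewrite sumr_const card_draws card_ord.
  rewrite inE => /eqP Bi.
  by rewrite Bi [#|~: B|]finset.cardsCs finset.setCK card_ord Bi.
move=> B; rewrite inE -val_eqE /=; case: eqP => [Bi|]; rewrite ?andbF // andbT.
rewrite /proper_nonempty -cards_eq0 Bi i0 /=.
apply: contra imax => /eqP BT; rewrite -val_eqE /= -Bi BT.
by rewrite cardsT card_ord.
Qed.

Lemma motivic_interior_permutohedron_bin n :
  motivic_interior (permutohedron n) = cls (permutohedron n) -
    \sum_(i < n.+1 | (i != ord0) && (i != ord_max))
      (cls (permutohedron i) * motivic_interior (permutohedron (n - i))) *+ 'C(n, i).
Proof.
rewrite motivic_interior_permutohedron.
by rewrite (sum_proper_nonempty n (fun k m =>
  cls (permutohedron k) * motivic_interior (permutohedron m))).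
Qed.

End Recurrence.

(** The sum is the coefficient of [x^n] in the product of the two series. It vanishes for n > 0
    because ['C(n, i) / n! = 1 / (i! (n - i)!)]. *)
Lemma egf_coef_recursion (A : comAlgType rat) (p q : nat -> A) n :
  q n = p n - \sum_(i < n.+1 | (i != ord0) && (i != ord_max))
                (p i * q (n - i)%N) *+ 'C(n, i) ->
  \sum_(i < n.+1)
    ((i == 0 :> nat)%:R
      + if i == 0 :> nat then 0 else (i`!%:R : rat)^-1 *: p i)
    * ((n - i == 0)%N%:R
      - if (n - i == 0)%N then 0 else ((n - i)`!%:R : rat)^-1 *: q (n - i)%N)
  = (n == 0)%N%:R.
Proof.
case: n => [|n]; first by rewrite big_ord1 /= subr0 addr0 mulr1.
(* The index 0 contributes [- q n / n!] and the index n contributes [p n / n!]; the middle terms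
   cancel against the sum in [qE]. *)
move=> qE; rewrite (bigD1 ord0) //= (bigD1 ord_max) //= subnn !eqxx /=.
rewrite !add0r !addr0 subr0 mulr1 mul1r qE.
rewrite subn0 scalerBr opprB addrA subrK scaler_sumr.
rewrite -big_split big1 //= => i /andP[]; rewrite -!val_eqE /= => /negPf i0 imax.
have i_lt : (i < n.+1)%N by rewrite ltn_neqAle imax -ltnS ltn_ord.
rewrite i0 subn_eq0 leqNgt i_lt /= add0r sub0r mulrN.
rewrite -scalerAl -scalerAr scalerA -scaler_nat scalerA -(bin_fact (ltnW i_lt)).
apply/eqP; rewrite subr_eq0; apply/eqP; congr (_ *: _).
rewrite !natrM !invfM; field; rewrite !pnatr_eq0 -!lt0n !fact_gt0 bin_gt0.
by rewrite ltnW.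
Qed.

(** Carries the integral recursion to rational coefficients, where factorials can be inverted. *)
Lemma rmorph_recursion (A B : comNzRingType) (f : {rmorphism A -> B})
    (p q : nat -> A) n (P : pred 'I_n.+1) :
  q n = p n - \sum_(i < n.+1 | P i) (p i * q (n - i)%N) *+ 'C(n, i) ->
  f (q n) = f (p n) - \sum_(i < n.+1 | P i) (f (p i) * f (q (n - i)%N)) *+ 'C(n, i).
Proof.
move=> ->; rewrite rmorphB rmorph_sum; congr (_ - _).
by apply: eq_bigr => i _; rewrite rmorphMn rmorphM.
Qed.

Theorem theorem3p5 (R : realType) :
  (1 + egf (fun n => cls (permutohedron R n)))
    * (1 - egf (fun n => motivic_interior (permutohedron R n))) = 1.
Proof.
(* The n-th coefficients of both sides unfold by conversion to the two sides of
   [egf_coef_recursion]. *)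
apply: fpsP => n; apply: (egf_coef_recursion (A := {malg rat[comb_class R]})
   (p := fun n => toQ (cls (permutohedron R n)))
   (q := fun n => toQ (motivic_interior (permutohedron R n)))).
exact: (rmorph_recursion (@toQ R) (p := fun n => cls (permutohedron R n))
  (q := fun n => motivic_interior (permutohedron R n))
  (motivic_interior_permutohedron_bin R n)).
Qed.
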